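(* For all $n\geq6$, the second largest eigenvalue of $A_{[5,1^{n-5}]}$ is $$\phi^{[n-1,1]}_{[5,1^{n-5}]}=\tfrac85\left(2n^5-30n^4+165n^3-405n^2+418n-120\right),$$ i.e. $\phi^\lambda_{[5,1^{n-5}]}\leq\phi^{[n-1,1]}_{[5,1^{n-5}]}$ for all $\lambda\vdash n$, $\lambda\neq[n]$. The spectral gap of the corresponding graph is $\phi^{[n]}_{[5,1^{n-5}]}-\phi^{[n-1,1]}_{[5,1^{n-5}]}=16n^4-152n^3+488n^2-592n+192$.
   Context: For $n\geq1$ let $\mathcal{M}_{2n}$ be the set of perfect matchings of $K_{2n}$ on $\{1,\dots,2n\}$. For $P,Q\in\mathcal{M}_{2n}$, $P\cup Q$ is a disjoint union of even cycles (a common edge counts as a $2$-cycle); if their lengths are $2\mu_1\geq\dots\geq 2\mu_k$, $P,Q$ are $\mu$-related, $\mu=[\mu_1,\dots,\mu_k]\vdash n$. $A_\mu$ is the $0/1$ matrix on $\mathcal{M}_{2n}$ with $(P,Q)$-entry $1$ iff $P,Q$ are $\mu$-related. The $A_\mu$ commute; their common eigenspaces are indexed by $\lambda\vdash n$, the $\lambda$-eigenspace being the isotypic component of the permutation representation of $S_{2n}$ on $\mathcal{M}_{2n}$ affording the Specht module $S^{2\lambda}$, $2\lambda=[2\lambda_1,2\lambda_2,\dots]$. $\phi^\lambda_\mu$ is the eigenvalue of $A_\mu$ on the $\lambda$-eigenspace; the largest eigenvalue is the valency $\phi^{[n]}_\mu$. $1^a$ denotes $a$ parts equal to $1$. *)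

(* Defs.v *)
From HB Require Import structures.
From mathcomp Require Import all_boot all_order all_algebra all_fingroup.
From mathcomp Require Import all_field all_character.

Set Implicit Arguments.
Unset Strict Implicit.
Unset Printing Implicit Defensive.

Import Order.TTheory GRing.Theory Num.Theory.
Local Open Scope ring_scope.

Definition is_partition_of (n : nat) (la : seq nat) : bool :=
  [&& sorted geq la, all (leq 1) la & sumn la == n].

Section PermutationRepresentation.

Variables (gT : finGroupType) (T : finType) (to : {action gT &-> T}).

(* MathComp representations act on row vectors from the right, so row x of the
   matrix of g is the basis vector of x acted on by g. *)
Definition permutation_mx (g : gT) : 'M[algC]_#|T| :=
  \matrix_(i, j) (to (enum_val i) g == enum_val j)%:R.

Lemma delta_permutation_mx (x : T) (g : gT) :
  delta_mx 0 (enum_rank x) *m permutation_mx g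
    = delta_mx 0 (enum_rank (to x g)) :> 'rV_#|T|.
Proof.
rewrite -rowE; apply/rowP => j; rewrite !mxE enum_rankK /= -(inj_eq enum_val_inj).
by rewrite enum_rankK eq_sym.
Qed.

Lemma permutation_mx_repr : mx_repr [set: gT] permutation_mx.
Proof.
split=> [|g h _ _]; apply/row_matrixP => i; rewrite !rowE -[i]enum_valK.
  by rewrite delta_permutation_mx act1 mulmx1.
by rewrite mulmxA !delta_permutation_mx actM.
Qed.

Definition permutation_repr : mx_representation algC [set: gT] #|T| :=
  MxRepresentation permutation_mx_repr.

End PermutationRepresentation.

Section Specht.

(* The cells of the diagram of nu, a partition of m, are numbered 0 .. m-1 row
   by row: cell x is in row [reshape_index nu x] and in column
   [reshape_offset nu x]. A tableau of shape nu is a bijection t : 'S_m, where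
   t x is the entry in cell x. *)
Variables (m : nat) (nu : seq nat).

(* Tabloids live in the type of all families of row contents indexed by the
   rows of nu; S_m acts on such families entrywise. *)
Definition row_family : predArgType := {ffun 'I_(size nu) -> {set 'I_m}}.

Definition row_family_act (T : row_family) (s : 'S_m) : row_family :=
  [ffun i => s @: T i].

Lemma row_family_act_is_action : is_action [set: 'S_m] row_family_act.
Proof.
apply: is_total_action => [T | T s u]; apply/ffunP => i; rewrite !ffunE.
  by rewrite (eq_imset _ (@perm1 _)) imset_id.
by rewrite -imset_comp; apply: eq_imset => x; rewrite permM.
Qed.

Canonical row_family_action := Action row_family_act_is_action.

Definition tabloid (t : 'S_m) : row_family :=
  [ffun i : 'I_(size nu) => [set t x | x : 'I_m & reshape_index nu x == i]].

Definition column_stabilizer (t : 'S_m) : {set 'S_m} :=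
  [set q : 'S_m | [forall y, reshape_offset nu (t^-1%g (q y))
                               == reshape_offset nu (t^-1%g y)]].

(* The product t * q in 'S_m is t followed by q, so tabloid (t * q) is the
   tabloid of t acted on by q. *)
Definition polytabloid (t : 'S_m) : 'rV[algC]_#|row_family| :=
  \sum_(q in column_stabilizer t)
    (-1) ^+ q *: delta_mx 0 (enum_rank (tabloid (t * q)%g)).

Definition tabloid_repr := permutation_repr row_family_action.

Definition specht_mx : 'M[algC]_#|row_family| :=
  (\sum_(t : 'S_m) <<polytabloid t>>)%MS.

Lemma tabloidM (t s : 'S_m) : row_family_act (tabloid t) s = tabloid (t * s)%g.
Proof.
apply/ffunP => i; rewrite !ffunE -imset_comp.
by apply: eq_imset => x; rewrite permM.
Qed.

Lemma polytabloidM (t s : 'S_m) :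
  polytabloid t *m tabloid_repr s = polytabloid (t * s)%g.
Proof.
rewrite mulmx_suml /polytabloid [RHS](reindex_inj (conjg_inj s)) /=.
apply: eq_big => [q | q _]; last first.
  rewrite -scalemxAl delta_permutation_mx /= tabloidM odd_permJ.
  by congr (_ *: delta_mx _ (enum_rank (tabloid _))); rewrite conjgE !mulgA mulgK.
rewrite !inE; apply/forallP/forallP => H y.
  have := H (s^-1%g y).
  by rewrite !invMg !permM permK.
have := H (s y).
by rewrite !invMg !permM !permK.
Qed.

Lemma specht_module : mxmodule tabloid_repr specht_mx.
Proof.
apply/mxmoduleP => s _; rewrite sumsmxMr; apply/sumsmx_subP => t _.
rewrite (eqmxMr _ (genmxE _)) polytabloidM (sumsmx_sup (t * s)%g) //.
by rewrite genmxE.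
Qed.

Definition specht_repr := submod_repr specht_module.

End Specht.

Definition is_perfect_matching n (P : {set {set 'I_(2 * n)}}) : bool :=
  partition P [set: 'I_(2 * n)] && [forall e in P, #|e| == 2].

Notation matching n :=
  {P : {set {set 'I_(2 * n)}} | is_perfect_matching P}.

Section Matchings.

Variable n : nat.

Definition edges_act (P : {set {set 'I_(2 * n)}}) (s : 'S_(2 * n)) :=
  [set s @: (e : {set 'I_(2 * n)}) | e in P].

Lemma edges_act_perfect (P : matching n) s :
  is_perfect_matching (edges_act (val P) s).
Proof.
case: P => P /= /andP[/and3P[/eqP covP tiP P0] /forallP P2].
have injs := @perm_inj _ s.
apply/andP; split; last first.
  apply/forallP => e; apply/implyP => /imsetP[f fP ->].
  by rewrite card_imset //; apply: (implyP (P2 f)).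
apply/and3P; split.
- apply/eqP/setP => x; rewrite inE; apply/bigcupP.
  have /bigcupP[e eP xe] : s^-1%g x \in cover P by rewrite covP inE.
  by exists (s @: e); [exact: imset_f | rewrite -[x](permKV s) imset_f].
- apply/trivIsetP => A B /imsetP[e eP ->] /imsetP[f fP ->] neq.
  rewrite -setI_eq0 -imsetI; last by move=> x y _ _ /injs.
  rewrite imset_eq0 setI_eq0; apply: (trivIsetP tiP) => //.
  by apply: contraNneq neq => ->.
- by apply/imsetP => -[e eP /esym/eqP]; rewrite imset_eq0 => /eqP e0; rewrite -e0 eP in P0.
Qed.

Definition matching_act (P : matching n) (s : 'S_(2 * n)) : matching n :=
  exist _ (edges_act (val P) s) (edges_act_perfect P s).

Lemma matching_act_is_action : is_action [set: 'S_(2 * n)] matching_act.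
Proof.
apply: is_total_action => [P | P s u]; apply: val_inj; rewrite /= /edges_act.
  rewrite -[RHS]imset_id; apply: eq_imset => e.
  by rewrite (eq_imset _ (@perm1 _)) imset_id.
rewrite -[RHS]imset_comp; apply: eq_imset => e /=.
by rewrite -imset_comp; apply: eq_imset => x; rewrite permM.
Qed.

Canonical matching_action := Action matching_act_is_action.

Definition matching_repr := permutation_repr matching_action.

Definition union_adj (P Q : matching n) : rel 'I_(2 * n) :=
  fun x y => (x != y) && ([set x; y] \in val P :|: val Q).

(* A cycle of length 2k of P u Q, including a common edge (k = 1), is a
   connected component with 2k vertices. *)
Definition relation_type (P Q : matching n) : seq nat :=
  sort geq [seq #|C|./2
           | C : {set 'I_(2 * n)} <- enum (equivalence_partition
               (connect (union_adj P Q)) [set: 'I_(2 * n)])].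

Definition A_ (mu : seq nat) : 'M[algC]_#|{: matching n}| :=
  \matrix_(i, j) (relation_type (enum_val i) (enum_val j) == mu)%:R.

(* U is an S_2n-submodule of the space of functions on matchings that is
   isomorphic to the Specht module of 2la. *)
Definition affords_specht (la : seq nat) (U : 'M[algC]_#|{: matching n}|) :=
  exists modU : mxmodule matching_repr U,
    mx_rsim (submod_repr modU)
            (specht_repr (2 * n) [seq (2 * k)%N | k <- la]).

(* x is the eigenvalue phi^la_mu of A_mu on the la-eigenspace. As U is simple,
   component_mx matching_repr U is the sum of all submodules isomorphic to U,
   and it is nonzero. *)
Definition is_phi (la mu : seq nat) (x : algC) :=
  exists2 U, affords_specht la U
           & (component_mx matching_repr U <= eigenspace (A_ mu) x)%MS.

End Matchings.

Section Spectrum.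

Variables (N : nat) (A : 'M[algC]_N).

Definition is_largest_eigenvalue (x : algC) :=
  eigenvalue A x /\ forall z, eigenvalue A z -> z <= x.

Definition is_second_largest_eigenvalue (y : algC) :=
  exists x, [/\ is_largest_eigenvalue x, eigenvalue A y, y < x
              & forall z, eigenvalue A z -> z != x -> z <= y].

Definition is_spectral_gap (g : algC) :=
  exists x y, [/\ is_largest_eigenvalue x, is_second_largest_eigenvalue y
                & g = x - y].

End Spectrum.

(* Main.v *)
Require Import Defs.
From mathcomp Require Import all_boot all_order all_algebra all_fingroup.
From mathcomp Require Import all_solvable all_field all_character.
From mathcomp Require Import zify ring.

(** A matching is encoded by the fixed-point-free involution exchanging the ends
    of its edges; P and Q are [5, 1^(n-5)]-related iff these involutions differ
    at exactly ten points and never commute there.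

    Removing a common edge preserves the relation.  Hence, if f is orthogonal to
    all indicator functions of edges, the quadratic form of A at f is a sum of
    the forms for n - 1, evaluated at the restrictions of f to the matchings
    through a given edge, which sum to zero.  The span of the indicator functions
    is the sum of the constants and of an eigenspace for the second eigenvalue
    (the [n-1,1] component), so an induction on n bounds the form on all functions
    that sum to zero.  For n = 5 the spectrum is computed: the operator summing
    over all transpositions preserves the seven relation classes, and its seven
    eigenvalues are distinct.

    Any two matchings can be exchanged by a permutation, so the commutant of the
    matching module is commutative and isotypic components lie in eigenspaces.
    The Specht module of 2 lambda embeds by sending a tabloid to the sum of the
    matchings whose edges lie in its rows; this is nonzero on a polytabloid, and
    James's submodule theorem gives simplicity. *)

Set Implicit Arguments.
Unset Strict Implicit.
Unset Printing Implicit Defensive.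

Import Order.TTheory GRing.Theory Num.Theory.

(** * Fixed-point-free involutions *)

(** The assertion fails for n = 5: there the eigenvalue of [4,1] is -48, the smallest of all, while
    the largest nontrivial one is 24. So the induction can only start at n = 6, on top of a cruder
    bound for n = 5. Write s_n for the second eigenvalue. For f orthogonal to the edge indicators, a
    bound c for n - 1 becomes n c / (n - 5) for n, since two related matchings share n - 5 of their
    n edges. The induction closes because n s_(n-1) <= (n - 5) s_n for n >= 7. For n = 6 the same
    inequality, with s_6 = 192, allows any c up to 32, which leaves room above 24.

    The inequality between eigenvalues is thus a statement about quadratic forms on functions.
    Representation theory serves to attach an eigenvalue to each partition and to identify those of
    [n] and [n-1,1]. A shape other than [n] cannot carry the valency, whose eigenspace is spanned by
    the constants. *)

Section Involutions.
Variable T : finType.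
Implicit Types (p q s : {perm T}) (V : {set T}) (x y u v : T).

Definition fpf_involution p := [forall x, (p x != x) && (p (p x) == x)].

Definition stable p V := [forall x in V, p x \in V].

(** These are the matchings of the points of V, kept as permutations of the whole type that agree
    with p off V. Deleting an edge only shrinks V ([family_edge]), so inductions on the number of
    points stay inside one type. *)
Definition family p V : {set {perm T}} :=
  [set q | fpf_involution q & [forall x, (x \notin V) ==> (q x == p x)]].

(* A point where p and q differ but commute lies on a 4-cycle of the union, so
   the ten points where they differ form a single cycle. *)
Definition related p q :=
  (#|[set x | p x != q x]| == 10)
    && [forall x, (p x != q x) ==> (p (q x) != q (p x))].

Lemma fpf_neq p x : fpf_involution p -> p x != x.
Proof. by move=> /forallP /(_ x) /andP[]. Qed.

Lemma fpfK p : fpf_involution p -> involutive p.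
Proof. by move=> fp x; move/forallP/(_ x)/andP: fp => [_ /eqP]. Qed.

Lemma fpf_eqC p x y : fpf_involution p -> (p x == y) = (p y == x).
Proof. by move=> fp; apply/eqP/eqP => <-; rewrite fpfK. Qed.

Lemma fpf_conj p s : fpf_involution p -> fpf_involution (p ^ s)%g.
Proof.
move=> fp; apply/forallP => x; rewrite -[x](permKV s) !permJ fpfK //.
by rewrite (inj_eq perm_inj) fpf_neq ?eqxx.
Qed.

Lemma stableP p V : reflect {in V, forall x, p x \in V} (stable p V).
Proof. exact: forall_inP. Qed.

Lemma stableE p V x : fpf_involution p -> stable p V -> (p x \in V) = (x \in V).
Proof.
move=> fp /stableP pV; apply/idP/idP => [/pV|/pV //]; by rewrite fpfK.
Qed.

Lemma familyP p V q :
  reflect (fpf_involution q /\ {in ~: V, q =1 p}) (q \in family p V).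
Proof.
rewrite inE; apply: (iffP andP) => -[fq H]; split=> //.
  by move=> x; rewrite inE => xV; apply/eqP; move/forallP/(_ x)/implyP: H; apply.
by apply/forallP => x; apply/implyP => xV; apply/eqP/H; rewrite inE.
Qed.

Lemma family_fpf p V q : q \in family p V -> fpf_involution q.
Proof. by case/familyP. Qed.

Lemma family_refl p V : fpf_involution p -> p \in family p V.
Proof. by move=> fp; apply/familyP. Qed.

Lemma family_eq p q V : q \in family p V -> family q V = family p V.
Proof.
case/familyP=> fq eqp; apply/setP => r.
by apply/familyP/familyP => -[fr er]; split=> // x xV; rewrite er ?eqp.
Qed.

Lemma family_setT p : family p [set: T] = [set q | fpf_involution q].
Proof.
apply/setP => q; rewrite !inE; case: fpf_involution => //=.
by apply/forallP => x; rewrite inE.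
Qed.

Lemma family_stable p q V :
  fpf_involution p -> stable p V -> q \in family p V -> stable q V.
Proof.
move=> fp pV /familyP[fq eqp]; apply/stableP => x xV; apply: contraLR (xV) => qxV.
by rewrite -[x](fpfK fq) eqp ?inE // stableE.
Qed.

Lemma family_edge p q V x : fpf_involution p -> stable p V -> q \in family p V ->
  [set r in family p V | r x == q x] = family q (V :\: [set x; q x]).
Proof.
move=> fp pV qF; have fq := family_fpf qF; apply/setP => r; rewrite -(family_eq qF).
rewrite inE; apply/andP/familyP=> [[/familyP[fr rq] /eqP rx]|[fr rq]].
  split=> // y; rewrite !inE negb_and negbK => /orP[/orP[] /eqP->//|yV].
    by rewrite -{1}rx !fpfK.
  by rewrite rq // inE.
split; last by rewrite rq // !inE eqxx.
by apply/familyP; split=> // y; rewrite inE => yV; rewrite rq // !inE (negPf yV) andbF.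
Qed.

Lemma stableD p V x :
  fpf_involution p -> stable p V -> stable p (V :\: [set x; p x]).
Proof.
move=> fp pV; apply/stableP => y; rewrite !inE stableE // => /andP[H ->].
rewrite andbT; apply: contra H => /orP[/eqP<-|/eqP/perm_inj->]; last by rewrite eqxx.
by rewrite fpfK // eqxx orbT.
Qed.

Lemma cardsD_edge p V x n : fpf_involution p -> stable p V -> x \in V ->
  #|V| = (2 * n.+1)%N -> #|V :\: [set x; p x]| = (2 * n)%N.
Proof.
move=> fp pV xV cV; have := cardsID [set x; p x] V.
rewrite (setIidPr _); last first.
  by apply/subsetP => y; rewrite !inE => /orP[]/eqP->; rewrite ?stableE.
by rewrite cards2 eq_sym fpf_neq // cV mulnS => /(congr1 (subn^~ 2)); rewrite !addKn.
Qed.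

Lemma family_conj p q V s : fpf_involution p -> stable p V ->
  {in ~: V, s =1 id} -> q \in family p V -> (q ^ s)%g \in family p V.
Proof.
move=> fp pV sV /familyP[fq eqp]; apply/familyP; split; first exact: fpf_conj.
move=> x xV; have sx : s x = x := sV x xV; rewrite -[in LHS]sx permJ eqp // sV //.
by move: xV; rewrite !inE stableE.
Qed.

Lemma tperm_id_off V x y : x \in V -> y \in V -> {in ~: V, tperm x y =1 id}.
Proof.
move=> xV yV z; rewrite inE => zV; rewrite tpermD //;
  by apply: contraNneq zV => <-.
Qed.

Lemma family_edge_exists p V x y : fpf_involution p -> stable p V ->
  x \in V -> y \in V -> x != y -> exists2 q, q \in family p V & q x = y.
Proof.
move=> fp pV xV yV xy; exists (p ^ tperm (p x) y)%g.
  by apply: family_conj; rewrite ?family_refl //; apply: tperm_id_off; rewrite ?stableE.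
have sx : tperm (p x) y x = x by rewrite tpermD ?fpf_neq // eq_sym.
by have := permJ p (tperm (p x) y) x; rewrite sx tpermL.
Qed.

Lemma related_conj p q s : related (p ^ s) (q ^ s) = related p q.
Proof.
congr (_ && _).
  rewrite -[in RHS](card_imset _ (@perm_inj _ s)); congr (_ == _); apply: eq_card => x.
  rewrite -[x](permKV s) (mem_imset _ _ (@perm_inj _ s)) !inE !permJ.
  by rewrite (inj_eq perm_inj).
apply/forallP/forallP => H x; last first.
  by rewrite -[x](permKV s) !permJ !(inj_eq perm_inj); apply: H.
by have := H (s x); rewrite !permJ !(inj_eq perm_inj).
Qed.

Lemma related_sym p q : related p q = related q p.
Proof.
congr (_ && _); first by congr (_ == _); apply: eq_card => x; rewrite !inE eq_sym.
by apply: eq_forallb => x; rewrite eq_sym [p (q x) == _]eq_sym.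
Qed.

(** The permutation exchanges two whole edges of p and therefore centralizes p. For z = p y the two
    transpositions would cancel; that case is served by [edge_flip]. *)
Lemma edge_swap p y z : fpf_involution p -> z != p y ->
  let s := (tperm y z * tperm (p y) (p z))%g in
  [/\ (p ^ s)%g = p, s y = z
    & forall x, x != y -> x != z -> x != p y -> x != p z -> s x = x].
Proof.
move=> fp zpy s.
have sy : s y = z by rewrite permM tpermL tpermD // ?fpf_neq // eq_sym.
have spy : s (p y) = p z.
  by rewrite permM [tperm y z _]tpermD ?tpermL // eq_sym ?fpf_neq // eq_sym.
have pzy : p z != y by rewrite fpf_eqC // eq_sym.
have [yz|yz] := eqVneq y z.
  have s1 : s = 1%g by rewrite /s yz !tperm1 mulg1.
  by rewrite s1 conjg1 perm1 yz; split=> // x; rewrite perm1.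
have pyz : p y != p z by rewrite (inj_eq perm_inj).
have sz : s z = y by rewrite permM tpermR tpermD // fpf_neq.
have spz : s (p z) = p y.
  by rewrite permM [tperm y z _]tpermD ?tpermR // eq_sym // fpf_neq.
have sx x : x != y -> x != z -> x != p y -> x != p z -> s x = x.
  by move=> *; rewrite permM !tpermD // eq_sym.
split=> //; apply/permP => x; rewrite -[x](permKV s) permJ.
move: (s^-1 x)%g => {}x.
have [->|xy] := eqVneq x y; first by rewrite sy spy.
have [->|xz] := eqVneq x z; first by rewrite sz spz.
have [->|xpy] := eqVneq x (p y); first by rewrite fpfK // sy spy fpfK.
have [->|xpz] := eqVneq x (p z); first by rewrite fpfK // sz spz fpfK.
rewrite !sx // ?(inj_eq perm_inj) //.
  by rewrite fpf_eqC // eq_sym.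
by rewrite fpf_eqC // eq_sym.
Qed.

(** This is the double factorial (2n - 1)!!. *)
Fixpoint odd_fact n := if n is m.+1 then (m.*2.+1 * odd_fact m)%N else 1%N.

Lemma card_family p V n : fpf_involution p -> stable p V -> #|V| = (2 * n)%N ->
  #|family p V| = odd_fact n.
Proof.
elim: n => [|n IHn] in p V *.
  move=> fp pV /eqP; rewrite muln0 cards_eq0 => /eqP->.
  rewrite (_ : family _ _ = [set p]) ?cards1 //; apply/setP => q; rewrite in_set1.
  apply/familyP/eqP => [[_ H]|->//]; apply/permP => x; apply: H; by rewrite !inE.
move=> fp pV cV; have [x xV] : exists x, x \in V.
  by apply/card_gt0P; rewrite cV mulnS.
have -> : #|family p V| = \sum_(y in V :\ x) #|[set q in family p V | q x == y]|.
  rewrite -sum1_card (partition_big (fun q : {perm T} => q x) (mem (V :\ x))) /=.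
    by apply: eq_bigr => y _; rewrite -sum1_card; apply: eq_bigl => q; rewrite !inE.
  move=> q qF; rewrite !inE fpf_neq ?(family_fpf qF) //.
  by rewrite stableE ?(family_fpf qF) // (family_stable fp pV qF).
rewrite (eq_bigr (fun _ => odd_fact n)) => [|y].
  rewrite sum_nat_const /=; congr (_ * _)%N; move/eqP: cV.
  by rewrite (cardsD1 x) xV mulnS eqSS => /eqP->; rewrite mul2n.
rewrite !inE eq_sym => /andP[xy yV].
have [q qF qx] := family_edge_exists fp pV xV yV xy.
rewrite -qx (family_edge x fp pV qF); have qV := family_stable fp pV qF.
have fq := family_fpf qF; apply: IHn; rewrite ?stableD //.
exact: cardsD_edge cV.
Qed.

End Involutions.

(** * The relation classes on ten points *)

(* Classes are recognized by the number of points where two matchings differ and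
   the number of those on 4-cycles; their order is 1^5, [2,1^3], [3,1,1],
   [2,2,1], [4,1], [3,2], [5], and 7 is the junk value. *)
Definition type_index (d t : nat) : nat :=
  index (d, t)
    [:: (0, 0); (4, 4); (6, 0); (8, 8); (8, 0); (10, 4); (10, 0)]%N.

Section PairLists.

Definition partner (i : nat) : nat := if odd i then i.-1 else i.+1.

Definition points (l : seq (nat * nat)) : seq nat :=
  flatten [seq [:: ab.1; ab.2] | ab <- l].

(** A matching of ten indices is given by the list of its edges and compared with the model matching
    [partner]. It commutes with the model at a point exactly when the model sends the edge at that
    point to another edge of the list, in either orientation. Counts of edges are doubled to give
    counts of points. *)
Definition pairs_type (l : seq (nat * nat)) : nat :=
  let d := [seq ab <- l | partner ab.1 != ab.2] in
  type_index (2 * size d)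
    (2 * count (fun ab => ((partner ab.1, partner ab.2) \in l)
                       || ((partner ab.2, partner ab.1) \in l)) d).

Definition swap_nat (i j a : nat) : nat :=
  if a == i then j else if a == j then i else a.

Definition swap_pairs (i j : nat) (l : seq (nat * nat)) :=
  [seq (swap_nat i j ab.1, swap_nat i j ab.2) | ab <- l].

Definition transposition_row (l : seq (nat * nat)) : seq nat :=
  let ts := [seq pairs_type (swap_pairs i j l) | i <- iota 0 10, j <- iota 0 10]
  in [seq count_mem m ts | m <- iota 0 7].

(* Entry (r, m): the number of ordered pairs (i, j) such that exchanging i and j
   in a matching of class r gives one of class m. *)
Definition transposition_table : seq (seq nat) :=
  [:: [:: 20; 80;  0;  0;  0;  0;  0];
      [::  4; 24; 48; 24;  0;  0;  0];
      [::  0; 12; 32;  0; 48;  8;  0];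
      [::  0;  8;  0; 28; 32; 32;  0];
      [::  0;  0; 16;  8; 44;  0; 32];
      [::  0;  0;  4; 12;  0; 36; 48];
      [::  0;  0;  0;  0; 20; 20; 60]]%N.

Definition row_ok (l : seq (nat * nat)) : bool :=
  transposition_row l == nth [::] transposition_table (pairs_type l).

(** The head of s is paired in turn with every other element, so each pairing is met once; k is
    fuel, and five rounds exhaust ten points. *)
Fixpoint all_pairings k (P : pred (seq (nat * nat))) (s : seq nat) acc :=
  match k, s with
  | _, [::] => P acc
  | k.+1, a :: r => all (fun b => all_pairings k P (rem b r) ((a, b) :: acc)) r
  | _, _ => false
  end.

Lemma all_rows_ok : all_pairings 5 row_ok (iota 0 10) [::].
Proof. by vm_cast_no_check (erefl true). Qed.
End PairLists.

Section TenPoints.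
Variable T : finType.
Implicit Types (p q s : {perm T}) (V : {set T}) (x y u v : T).

Definition diff_card p q := #|[set x | p x != q x]|.
Definition square_card p q := #|[set x | (p x != q x) && (p (q x) == q (p x))]|.
Definition rel_type p q := type_index (diff_card p q) (square_card p q).

Lemma rel_type_sym p q : rel_type p q = rel_type q p.
Proof.
congr type_index; apply: eq_card => x; rewrite !inE eq_sym //.
by rewrite [p (q x) == _]eq_sym.
Qed.

Lemma partner_lt i n : (i < 2 * n)%N -> (partner i < 2 * n)%N.
Proof.
rewrite /partner; case: ifP => [_|oi]; first exact: leq_ltn_trans (leq_pred _).
by rewrite !mul2n -!ltn_half_double /= uphalf_half oi.
Qed.

(** Listing V edge by edge turns p into [partner] on positions. This transports the computation on 0
    .. 9 to an arbitrary set of ten points. *)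
Lemma adapted_enum p V n : fpf_involution p -> stable p V -> #|V| = (2 * n)%N ->
  exists s : seq T, [/\ uniq s, size s = (2 * n)%N, s =i V
    & forall x0 i, (i < 2 * n)%N -> p (nth x0 s i) = nth x0 s (partner i)].
Proof.
elim: n => [|n IHn] in p V * => fp pV cV.
  move/eqP: cV; rewrite muln0 cards_eq0 => /eqP->; exists [::]; split=> // x.
  by rewrite inE.
have [x xV] : exists x, x \in V by apply/card_gt0P; rewrite cV mulnS.
have [s [Us ss sV sp]] :=
  IHn p _ fp (stableD x fp pV) (cardsD_edge fp pV xV cV).
exists (x :: p x :: s); split=> /=.
- rewrite !inE !sV !inE !eqxx ?orbT /= ?orbF ?andbT; apply/andP; split=> //.
  by rewrite eq_sym fpf_neq.
- by rewrite ss mulnS.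
- move=> y; rewrite !inE sV !inE orbA.
  have [E|_ //] := boolP ((y == x) || (y == p x)).
  by rewrite /=; case/orP: E => /eqP->; rewrite ?stableE.
move=> x0 [|[|i]] //; first by rewrite /= fpfK.
rewrite mulnS /partner /= negbK !ltnS => lti.
rewrite sp // /partner; case: ifP => //.
by case: i lti.
Qed.

Variables (p : {perm T}) (V : {set T}) (s : seq T) (x0 : T).
Hypotheses (fp : fpf_involution p) (pV : stable p V).
Hypotheses (Us : uniq s) (ss : size s = 10) (sV : s =i V).
Hypothesis sp : forall i, (i < 10)%N -> p (nth x0 s i) = nth x0 s (partner i).

Let g := nth x0 s.

Let g_inj i j : (i < 10)%N -> (j < 10)%N -> (g i == g j) = (i == j).
Proof. by move=> i10 j10; rewrite nth_uniq ?ss. Qed.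

Let partner10 i : (i < 10)%N -> (partner i < 10)%N.
Proof. exact: (@partner_lt i 5). Qed.

Definition lists_pairs q (l : seq (nat * nat)) :=
  perm_eq (points l) (iota 0 10) && all (fun ab => q (g ab.1) == g ab.2) l.

Lemma mem_points l a b : (a, b) \in l -> a \in points l /\ b \in points l.
Proof.
by move=> abl; split; apply/flattenP; exists [:: a; b];
  rewrite ?inE ?eqxx ?orbT //; apply/mapP; exists (a, b).
Qed.

Lemma lists_pairsP q l : lists_pairs q l ->
  forall a b, (a, b) \in l -> [/\ (a < 10)%N, (b < 10)%N & q (g a) = g b].
Proof.
case/andP=> pl /allP ql a b abl; have [al bl] := mem_points abl.
by move: al bl; rewrite !(perm_mem pl) !mem_iota /= => al bl; split=> //;
  apply/eqP/(ql (a, b)).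
Qed.

Lemma count_points (P : pred nat) l : {in l, forall ab, P ab.1 = P ab.2} ->
  count P (points l) = (2 * count (fun ab => P ab.1) l)%N.
Proof.
elim: l => // -[a b] l IHl H /=; rewrite -/(points l) IHl; last first.
  by move=> ab abl; apply: H; rewrite inE abl orbT.
by rewrite -(H (a, b)) ?mem_head //=; case: (P a); rewrite mulnDr.
Qed.

Lemma card_points q l (P : pred T) :
  lists_pairs q l -> (forall x, P x -> x \in V) -> (forall x, P (q x) = P x) ->
  #|[set x | P x]| = (2 * count (fun ab => P (g ab.1)) l)%N.
Proof.
move=> ql PV Pq.
rewrite -(@count_points (fun i => P (g i))); last first.
  by move=> [a b] /(lists_pairsP ql)[_ _ /= <-].
case/andP: ql => /seq.permP-> _.
have -> : iota 0 10 = iota 0 (size s) by rewrite ss.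
rewrite -(@count_map _ _ g P) -/(mkseq g (size s)) mkseq_nth -size_filter.
rewrite -(card_uniqP (filter_uniq P Us)); apply: eq_card => x.
by rewrite inE mem_filter sV; case: (boolP (P x)) => // /PV->.
Qed.

Lemma rel_type_pairs q l : q \in family p V -> lists_pairs q l ->
  rel_type p q = pairs_type l.
Proof.
move=> qF ql; have fq := family_fpf qF.
have off x : p x != q x -> x \in V.
  apply: contraR => xV; case/familyP: qF => _ ->; rewrite ?inE //.
have step x : (p (q x) != q (q x)) = (p x != q x).
  by rewrite fpfK // fpf_eqC // eq_sym.
rewrite /rel_type /pairs_type; congr type_index.
  rewrite /diff_card (card_points ql off step) size_filter; congr (2 * _)%N.
  apply: eq_in_count => -[a b] /(lists_pairsP ql)[a10 b10 /= ->].
  by rewrite sp // g_inj ?partner10.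
rewrite /square_card
  (@card_points q l (fun x => (p x != q x) && (p (q x) == q (p x)))) //.
- rewrite count_filter; congr (2 * _)%N.
  apply: eq_in_count => -[a b] /(lists_pairsP ql)[a10 b10 /= qa].
  rewrite qa !sp // g_inj ?partner10 // andbC -/g; congr (_ && _).
  have pa10 := partner10 a10; have pb10 := partner10 b10.
  have [pl _] := andP ql.
  apply/eqP/orP => [qpa | [] /(lists_pairsP ql)[_ _]//]; last first.
    by move=> <-; rewrite fpfK.
  have : partner a \in points l by rewrite (perm_mem pl) mem_iota.
  case/flattenP => _ /mapP[[c d] cdl ->]; rewrite !inE /=.
  have [c10 d10 qc] := lists_pairsP ql cdl.
  case/orP=> /eqP E; move: qpa; rewrite E.
    by rewrite qc => /eqP; rewrite g_inj // => /eqP->; left.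
  rewrite -qc fpfK // => /eqP; rewrite g_inj // => /eqP->; by right.
- by move=> x /andP[/off].
by move=> x; rewrite step fpfK //; congr (_ && _); rewrite eq_sym fpf_eqC // eq_sym.
Qed.

Lemma swap_natE i j a : (i < 10)%N -> (j < 10)%N -> (a < 10)%N ->
  (swap_nat i j a < 10)%N /\ g (swap_nat i j a) = tperm (g i) (g j) (g a).
Proof.
move=> i10 j10 a10; rewrite /swap_nat; case: eqP => [->|/eqP ai].
  by rewrite tpermL.
case: eqP => [->|/eqP aj]; first by rewrite tpermR.
by rewrite tpermD // g_inj // eq_sym.
Qed.

Lemma swap_pairsP q l i j : (i < 10)%N -> (j < 10)%N -> lists_pairs q l ->
  lists_pairs (q ^ tperm (g i) (g j))%g (swap_pairs i j l).
Proof.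
move=> i10 j10 ql; have [pl _] := andP ql; apply/andP; split.
  have -> : points (swap_pairs i j l) = map (swap_nat i j) (points l).
    rewrite /points map_flatten -!map_comp; congr flatten; exact: eq_map.
  have inj_sw : {in points l &, injective (swap_nat i j)}.
    move=> a b; rewrite !(perm_mem pl) !mem_iota /= => a10 b10 E.
    have [_ Ea] := swap_natE i10 j10 a10; have [_ Eb] := swap_natE i10 j10 b10.
    by move: Ea; rewrite E Eb => /perm_inj/eqP; rewrite g_inj // => /eqP->.
  have Ul : uniq (points l) by rewrite (perm_uniq pl) iota_uniq.
  have Usw : uniq (map (swap_nat i j) (points l)) by rewrite map_inj_in_uniq.
  have sub : {subset map (swap_nat i j) (points l) <= iota 0 10}.
    move=> _ /mapP[a al ->]; move: al; rewrite (perm_mem pl) !mem_iota /= => a10.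
    by have [] := swap_natE i10 j10 a10.
  apply: uniq_perm; rewrite ?iota_uniq //.
  by have [|_ E] := uniq_min_size Usw sub; rewrite ?size_map ?(perm_size pl).
apply/allP => _ /mapP[[a b] abl ->] /=.
have [a10 b10 qa] := lists_pairsP ql abl.
have [_ ->] := swap_natE i10 j10 a10; have [_ ->] := swap_natE i10 j10 b10.
by rewrite permJ qa.
Qed.

(** In each round one follows the branch that pairs the head with its image under q; the leaf
    reached lists edges of q only. *)
Lemma all_pairingsP (P : pred (seq (nat * nat))) k r acc q :
    fpf_involution q -> all_pairings k P r acc -> uniq r ->
    {in r, forall a, (a < 10)%N /\ exists2 b, b \in r & q (g a) = g b} ->
    all (fun ab => q (g ab.1) == g ab.2) acc ->
  exists l, [/\ P l, perm_eq (points l) (r ++ points acc)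
               & all (fun ab => q (g ab.1) == g ab.2) l].
Proof.
move=> fq; elim: k r acc => [|k IHk] [|a r] acc //=; try by exists acc.
move=> /allP allP /andP[ar Ur] qr qacc.
have [a10 [b + qa]] := qr a (mem_head _ _); rewrite inE => /orP[/eqP E|br].
  by have := fpf_neq (g a) fq; rewrite qa E eqxx.
have [b10 _] : (b < 10)%N /\ exists2 c, c \in a :: r & q (g b) = g c.
  by apply: qr; rewrite inE br orbT.
have ab : a != b by apply: contraNneq ar => ->.
have [|||l [Pl pl ql]] := IHk _ _ (allP b br); rewrite ?rem_uniq //=.
- move=> c; rewrite mem_rem_uniq // !inE => /andP[cb cr].
  have [|c10 [d]] := qr c; rewrite ?inE ?cr ?orbT // => + qc; split=> //.
  exists d => //; rewrite mem_rem_uniq // !inE.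
  case/orP: p0 => [/eqP E|dr].
    by move: cb; rewrite -(g_inj c10 b10) -qa -E -qc fpfK // eqxx.
  rewrite dr andbT; apply: contraNneq ar => E; suff -> : a = c by [].
  by apply/eqP; rewrite -(g_inj a10 c10) -[g a](fpfK fq) qa -E -qc fpfK.
- by rewrite qa eqxx.
exists l; split=> //; apply: perm_trans pl _.
rewrite /points /= -/(points acc) -[_ :: b :: _]/([:: a; b] ++ _) perm_catCA /=.
rewrite perm_cons -cat_cons perm_cat2r perm_sym; exact: perm_to_rem.
Qed.

Lemma row_list q : q \in family p V -> exists2 l, row_ok l & lists_pairs q l.
Proof.
move=> qF; have fq := family_fpf qF; have qV := family_stable fp pV qF.
have [||l [Pl pl ql]] := all_pairingsP fq all_rows_ok (iota_uniq _ _).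
- move=> a; rewrite mem_iota => /andP[_ a10]; split=> //.
  have /(nthP x0)[b] : q (g a) \in s by rewrite sV stableE // -sV mem_nth ?ss.
  by rewrite ss => b10 qa; exists b; rewrite ?mem_iota // -qa.
- by [].
by exists l => //; rewrite /lists_pairs ql -[iota 0 10]cats0 pl.
Qed.

Lemma rel_type_lt q : q \in family p V -> (rel_type p q < 7)%N.
Proof.
move=> qF; have [l /eqP + lq] := row_list qF; rewrite -(rel_type_pairs qF lq).
by move=> row; rewrite ltnNge; apply/negP => ge7; move: row; rewrite [RHS]nth_default.
Qed.

Lemma transposition_row_sum q (R : pzRingType) (w : nat -> R) : q \in family p V ->
  (\sum_(x in V) \sum_(y in V) w (rel_type p (q ^ tperm x y)%g)
    = \sum_(m < 7)
        w m *+ nth 0%N (nth [::] transposition_table (rel_type p q)) m)%R.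
Proof.
move=> qF; have [l /eqP + lq] := row_list qF.
rewrite -(rel_type_pairs qF lq) => <-.
have sumV (F : T -> R) : (\sum_(x in V) F x = \sum_(i <- iota 0 10) F (g i))%R.
  rewrite -(eq_bigl _ _ sV) -big_uniq //= -[s in LHS](mkseq_nth x0) ss.
  by rewrite /mkseq big_map.
set ts := [seq pairs_type (swap_pairs i j l) | i <- iota 0 10, j <- iota 0 10].
have typ i j : i \in iota 0 10 -> j \in iota 0 10 ->
    [/\ (q ^ tperm (g i) (g j))%g \in family p V
      & rel_type p (q ^ tperm (g i) (g j)) = pairs_type (swap_pairs i j l)].
  rewrite !mem_iota => /andP[_ i10] /andP[_ j10].
  have qtF : (q ^ tperm (g i) (g j))%g \in family p V.
    by apply: family_conj => //; apply: tperm_id_off; rewrite -sV mem_nth ?ss.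
  by split=> //; apply: rel_type_pairs; last exact: swap_pairsP.
have lt7 t : t \in ts -> (t < 7)%N.
  case/allpairsP=> -[i j] [/= i10 j10 ->].
  by have [qtF <-] := typ i j i10 j10; apply: rel_type_lt.
transitivity (\sum_(t <- ts) w t)%R.
  rewrite sumV big_allpairs_dep; apply: eq_big_seq => i i10.
  by rewrite sumV; apply: eq_big_seq => j j10; have [_ ->] := typ i j i10 j10.
transitivity (\sum_(t <- ts) \sum_(m < 7 | val m == t) w m)%R.
  by apply: eq_big_seq => t /lt7 t7; rewrite (big_pred1 (Ordinal t7)).
rewrite (exchange_big_dep xpredT) //=; apply: eq_bigr => m _.
rewrite big_const_seq iter_addr_0 (nth_map 0%N) ?size_iota // nth_iota //.
by congr (_ *+ _)%R; apply: eq_count => t; rewrite eq_sym.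
Qed.

End TenPoints.

(** * Matchings as involutions *)

Section Components.
Variables (T : finType) (p q : {perm T}).
Hypotheses (fp : fpf_involution p) (fq : fpf_involution q).

Lemma card_stable_even r (V : {set T}) : fpf_involution r -> stable r V -> ~~ odd #|V|.
Proof.
move=> fr; have [m] := ubnP #|V|; elim: m V => // m IHm V leV rV.
have [->|[x xV]] := set_0Vmem V; first by rewrite cards0.
have c2 : #|V| = #|V :\: [set x; r x]|.+2.
  rewrite -(cardsID [set x; r x] V) (setIidPr _) ?cards2 1?eq_sym ?fpf_neq //.
  by apply/subsetP => y; rewrite !inE => /orP[]/eqP->; rewrite ?stableE.
by rewrite c2 /= negbK IHm ?stableD // -ltnS; apply: leq_trans leV; rewrite c2.
Qed.

Definition union_rel : rel T := fun x y => (y == p x) || (y == q x).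

Definition component x : {set T} := [set y | connect union_rel x y].

Lemma union_rel_sym : connect_sym union_rel.
Proof.
apply: sym_connect_sym => x y; rewrite /union_rel.
by rewrite (eq_sym y (p x)) (eq_sym y (q x)) !(fpf_eqC x) // (eq_sym x (p y)) (eq_sym x (q y)).
Qed.

Lemma component_refl x : x \in component x.
Proof. by rewrite inE connect0. Qed.

Lemma component_eq x y : y \in component x -> component y = component x.
Proof.
rewrite inE => xy; apply/setP => z.
by rewrite !inE (same_connect union_rel_sym xy).
Qed.

Lemma component_p x y : (p y \in component x) = (y \in component x).
Proof.
rewrite !inE; have yp : connect union_rel y (p y).
  by apply: connect1; rewrite /union_rel eqxx.
by rewrite (same_connect_r union_rel_sym yp).
Qed.

Lemma component_q x y : (q y \in component x) = (y \in component x).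
Proof.
rewrite !inE; have yp : connect union_rel y (q y).
  by apply: connect1; rewrite /union_rel eqxx orbT.
by rewrite (same_connect_r union_rel_sym yp).
Qed.

Lemma component_sub x (S : {set T}) :
  x \in S -> stable p S -> stable q S -> component x \subset S.
Proof.
move=> xS pS qS; have clS : closed union_rel (mem S).
  by move=> y z /orP[]/eqP->; rewrite stableE.
by apply/subsetP => y; rewrite inE => /(closed_connect clS) <-.
Qed.

Lemma component_even x : ~~ odd #|component x|.
Proof.
by apply: (card_stable_even fp); apply/stableP => y; rewrite component_p.
Qed.

Lemma component_card2 x : (#|component x| == 2) = (p x == q x).
Proof.
have sub : [set x; p x] \subset component x.
  by rewrite subUset !sub1set component_p component_refl.
have c2 : #|[set x; p x]| = 2 by rewrite cards2 eq_sym fpf_neq.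
apply/idP/idP => [cx|/eqP pq].
  have /eqP/setP/(_ (q x)) : [set x; p x] == component x by rewrite eqEcard sub c2 (eqP cx).
  rewrite component_q component_refl !inE (negPf (fpf_neq x fq)) /=.
  by move/eqP->.
suff -> : component x = [set x; p x] by rewrite c2.
apply/eqP; rewrite eqEsubset sub andbT; apply: component_sub.
- by rewrite !inE eqxx.
- by apply/stableP => y; rewrite !inE => /orP[]/eqP->; rewrite ?fpfK ?eqxx ?orbT.
apply/stableP => y; rewrite !inE pq.
by case/orP => /eqP->; rewrite ?fpfK ?eqxx ?orbT.
Qed.

(** If p x and q x differ, then x, p x and q x are distinct. A fourth and last point of the
    component must be both p (q x) and q (p x); conversely, if these agree, the four points are
    closed under p and q. *)
Lemma component_card4 x :
  (#|component x| == 4) = (p x != q x) && (p (q x) == q (p x)).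
Proof.
have sub : [set x; p x; q x] \subset component x.
  by rewrite !subUset !sub1set component_p component_q component_refl.
have [pq|pq] /= := eqVneq (p x) (q x).
  by have := component_card2 x; rewrite pq eqxx => /eqP->.
have c3 : #|[set x; p x; q x]| = 3.
  rewrite setUC cardsU1 cards2 !inE negb_or (fpf_neq x fq) eq_sym pq.
  by rewrite eq_sym fpf_neq.
apply/idP/idP => [/eqP c4|/eqP pqx].
  have : #|component x :\: [set x; p x; q x]| = 1%N.
    by rewrite cardsD (setIidPr sub) c3 c4.
  move/eqP/cards1P=> [z zE].
  have inz y : y \in component x -> y != x -> y != p x -> y != q x -> y = z.
    move=> yC yx ypx yqx; apply/set1P; rewrite -zE in_setD yC andbT !inE !negb_or.
    by rewrite yx ypx yqx.
  have pz : p (q x) = z.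
    apply: inz; rewrite ?component_p ?component_q ?component_refl ?fpf_neq //.
      by rewrite fpf_eqC.
    by rewrite (inj_eq perm_inj) fpf_neq.
  have qz : q (p x) = z.
    apply: inz; rewrite ?component_q ?component_p ?component_refl ?fpf_neq //.
      by rewrite fpf_eqC // eq_sym.
    by rewrite (inj_eq perm_inj) fpf_neq.
  by rewrite pz qz.
have sub4 : component x \subset p (q x) |: [set x; p x; q x].
  apply: component_sub; first by rewrite !inE eqxx !orbT.
    apply/stableP => y; rewrite !inE -!orbA.
    by case/or4P => /eqP->; rewrite ?fpfK ?eqxx ?orbT.
  apply/stableP => y; rewrite !inE -!orbA.
  by case/or4P => /eqP->; rewrite ?pqx ?fpfK ?eqxx ?orbT.
have le4 : (#|component x| <= 4)%N.
  by apply: leq_trans (subset_leq_card sub4) _; rewrite cardsU1 c3; case: (_ \notin _).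
have := subset_leq_card sub; rewrite c3 => ge3.
have := component_even x; move: le4 ge3.
by case: #|_| => [|[|[|[|[|m]]]]].
Qed.

Lemma mem_components (C : {set T}) :
  reflect (exists x, C = component x)
          (C \in equivalence_partition (connect union_rel) [set: T]).
Proof.
apply: (iffP imsetP) => [[x _ ->]|[x ->]]; exists x => //;
  by apply/setP => y; rewrite !inE.
Qed.

Lemma components_partition :
  partition (equivalence_partition (connect union_rel) [set: T]) [set: T].
Proof.
apply: equivalence_partitionP => x y z _ _ _; split; first exact: connect0.
by move=> xy; rewrite (same_connect union_rel_sym xy).
Qed.

Definition component_type : seq nat :=
  sort geq [seq #|C|./2 | C : {set T}
              <- enum (equivalence_partition (connect union_rel) [set: T])].

Lemma related_components : related p q
  = (#|[set x | #|component x| != 2]| == 10) && [forall x, #|component x| != 4].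
Proof.
congr (_ && _).
  by congr (_ == _); apply: eq_card => x; rewrite !inE component_card2.
apply: eq_forallb => x; rewrite component_card4.
by case: eqP => //= _; case: eqP.
Qed.

Local Notation blocks := (equivalence_partition (connect union_rel) [set: T]).

Lemma component_half x m : (#|component x|./2 == m) = (#|component x| == m.*2).
Proof.
have := odd_double_half #|component x|; rewrite (negPf (component_even x)) add0n.
by move=> E; rewrite -[in RHS]E (inj_eq double_inj).
Qed.

(** For the converse direction: components are even, so one having neither 2 nor 4 points has at
    least 6, and the ten points of [D] cannot hold two of them. All other components are common
    edges, and their number m follows from the size of T. *)
Lemma component_typeE m : #|T| = (2 * (m + 5))%N ->
  (component_type == 5 :: nseq m 1%N) = related p q.
Proof.
move=> cT; rewrite related_components /component_type.
set l := map _ _.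
have sortedE : (sort geq l == 5 :: nseq m 1%N) = perm_eq l (5 :: nseq m 1%N).
  have geq_tot : total geq by move=> a b; apply: leq_total.
  have geq_tr : transitive geq by move=> a b c /= ba cb; apply: leq_trans ba.
  have geq_as : antisymmetric geq.
    by move=> a b /andP[/= ba ab]; apply/eqP; rewrite eqn_leq ba ab.
  have srt : sorted geq (5 :: nseq m 1%N).
    by rewrite /= (@path_min_sorted _ geq) ?all_nseq ?orbT //; elim: (m) => //= -[|k].
  rewrite -{1}(sorted_sort geq_tr srt); apply/eqP/idP => [|E].
    by move/(perm_sortP geq_tot geq_tr geq_as).
  exact/(perm_sortP geq_tot geq_tr geq_as).
have in_l x : #|component x|./2 \in l.
  by apply/mapP; exists (component x) => //; rewrite mem_enum; apply/mem_components; exists x.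
rewrite sortedE; apply/idP/andP => [lE | [/eqP d10 /forallP n4]].
  have typ x : (#|component x| == 10) || (#|component x| == 2).
    have := in_l x; rewrite (perm_mem lE) inE mem_nseq.
    by rewrite (component_half x 5) -(component_half x 1) => /orP[->//|/andP[_ ->]]; rewrite orbT.
  split; last by apply/forallP => x; case/orP: (typ x) => /eqP->.
  have : count (pred1 5) l = 1%N.
    by move/seq.permP: lE => ->; rewrite /= count_nseq.
  rewrite count_map -size_filter; set fives := filter _ _ => sz1.
  have in5 x : #|component x| = 10 -> component x \in fives.
    move=> c10; rewrite mem_filter /= c10 mem_enum; apply/mem_components; by exists x.
  have same5 x y : #|component x| = 10 -> #|component y| = 10 -> component x = component y.
    move=> /in5 x5 /in5; case: (fives) sz1 x5 => [|C [|//]] // _.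
    by rewrite !mem_seq1 => /eqP-> /eqP->.
  have [x0 x010] : exists x, #|component x| = 10.
    have : 5 \in l by rewrite (perm_mem lE) mem_head.
    case/mapP=> C; rewrite mem_enum => /mem_components[x ->] /esym/eqP.
    by rewrite component_half => /eqP; exists x.
  rewrite -x010; apply/eqP/eq_card => y; rewrite [LHS]in_set.
  apply/idP/idP => [|/component_eq->]; last by rewrite x010.
  case/orP: (typ y) => /eqP y10; rewrite y10 // => _.
  by rewrite -(same5 y x0 y10 x010) component_refl.
set D := [set x | _] in d10.
have DE y : (y \in D) = (#|component y| != 2) by rewrite inE.
have [x0 x0D] : exists x, x \in D by apply/card_gt0P; rewrite d10.
have subD y : y \in D -> component y \subset D.
  by rewrite DE => yD; apply/subsetP => z /component_eq; rewrite DE => ->.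
have ge6 y : y \in D -> (6 <= #|component y|)%N.
  rewrite DE; have := n4 y; have := component_even y.
  have : (0 < #|component y|)%N by apply/card_gt0P; exists y; apply: component_refl.
  by case: #|_| => [|[|[|[|[|[|k]]]]]].
have C0D : component x0 = D.
  apply/eqP; rewrite eqEsubset subD //=; apply/subsetP => y yD; apply/negPn/negP => yC.
  have dis : component x0 :&: component y = set0.
    apply/setP => z; rewrite in_setI [RHS]inE; apply/negP.
    move=> /andP[/component_eq E1 /component_eq E2].
    by case/negP: yC; rewrite -E1 E2 component_refl.
  have : (#|component x0 :|: component y| <= #|D|)%N.
    by apply: subset_leq_card; rewrite subUset !subD.
  rewrite cardsU dis cards0 subn0 d10; have := ge6 _ x0D; have := ge6 _ yD; lia.
have C0B : component x0 \in blocks by apply/mem_components; exists x0.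
have two C : C \in blocks :\ component x0 -> #|C| = 2.
  rewrite in_setD1 => /andP[neC /mem_components[y CE]]; rewrite CE in neC *.
  apply/eqP; apply: contraR neC; rewrite -DE -C0D => /component_eq->; exact: eqxx.
have cm : #|blocks :\ component x0| = m.
  have := card_partition components_partition.
  rewrite cardsT cT (big_setD1 _ C0B) (eq_bigr _ two) sum_nat_const /=.
  by rewrite C0D d10; lia.
have enumE : perm_eq (enum blocks) (component x0 :: enum (blocks :\ component x0)).
  apply: uniq_perm; rewrite ?enum_uniq //=.
    by rewrite mem_enum in_setD1 eqxx enum_uniq.
  by move=> C; rewrite inE !mem_enum in_setD1; case: eqVneq => // ->.
apply: perm_trans (perm_map _ enumE) _; rewrite /= C0D d10 perm_cons.
set ones := map _ _; have /all_pred1P -> : all (pred1 1%N) ones.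
  by apply/allP => _ /mapP[C + ->]; rewrite mem_enum -C0D => Cb; rewrite /= (two C Cb).
by rewrite size_map -cardE -C0D cm.
Qed.

End Components.

(* The exchange reflects each cycle of the union through a chosen base point. *)
Section Swap.

Local Open Scope group_scope.

Variables (T : finType) (p q : {perm T}).
Hypotheses (fp : fpf_involution p) (fq : fpf_involution q).

Local Notation r := (p * q).
Implicit Types (g h : {perm T}) (b x y : T).

Let pp : p * p = 1. Proof. by apply/permP => x; rewrite permM fpfK // perm1. Qed.
Let qq : q * q = 1. Proof. by apply/permP => x; rewrite permM fpfK // perm1. Qed.

Let rot_conj g : g \in <[r]> -> g ^ p = g^-1.
Proof.
case/cycleP=> k ->; rewrite conjXg -expgVn; congr (_ ^+ _).
have pV : p^-1 = p by apply: (mulgI p); rewrite mulgV pp.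
have qV : q^-1 = q by apply: (mulgI q); rewrite mulgV qq.
by rewrite conjgE !mulgA mulVg mul1g invMg pV qV.
Qed.

Let p_rot g x : g \in <[r]> -> p (g x) = g^-1 (p x).
Proof. by move=> gr; rewrite -(rot_conj gr) permJ. Qed.

Let rotC g h x : g \in <[r]> -> h \in <[r]> -> g (h x) = h (g x).
Proof.
move=> gr hr; rewrite -!permM; congr (fun_of_perm _ x).
exact: (centsP (cycle_abelian r)).
Qed.

Let r_in : r \in <[r]>. Proof. exact: cycle_id. Qed.

Let q_rot g x : g \in <[r]> -> q (g x) = p ((g^-1 * r)^-1 x).
Proof.
move=> gr; have hr : (g^-1 * r)^-1 \in <[r]> by rewrite groupV groupM ?groupV.
by rewrite (p_rot _ hr) invgK permM -(p_rot _ gr) permM fpfK.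
Qed.

(** On a cycle, rotations and reflections have disjoint orbits. If r^m b = p b, then halfway along,
    at c = r^(m/2) b, one gets p c = c for m even and p c = q (p c) for m odd, a fixed point of p or
    of q. *)
Let p_notin_rot g b : g \in <[r]> -> g b != p b.
Proof.
case/cycleP=> m ->; apply/eqP => E.
have rk k : r ^+ k \in <[r]> by rewrite mem_cycle.
pose c := (r ^+ m./2) b.
have pc : p c = (r ^+ (odd m)) c.
  rewrite /c p_rot // -E -permM -permM; congr (fun_of_perm _ b).
  have -> : r ^+ m = r ^+ odd m * r ^+ m./2 * r ^+ m./2.
    by rewrite -!expgD -addnA addnn odd_double_half.
  by rewrite mulgK -!expgD addnC.
case: (odd m) pc => /=.
  rewrite expg1 permM => pc; have := fpf_neq (p c) fq; by rewrite -pc eqxx.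
by rewrite expg0 perm1 => pc; have := fpf_neq c fp; rewrite pc eqxx.
Qed.

(** Since [pick] sees only the component as a set, all points of a component get the same base
    point. *)
Let base x := odflt x [pick y in component p q x].

Let base_in x : base x \in component p q x.
Proof.
rewrite /base; case: pickP => [y //|none] /=; exact: component_refl.
Qed.

Let base_eq x y : y \in component p q x -> base y = base x.
Proof.
move=> /(component_eq fp fq) E; rewrite /base E.
by case: pickP => // /(_ x); rewrite component_refl.
Qed.

Let base_id x : base (base x) = base x.
Proof. exact/base_eq/base_in. Qed.

Let base_rot g x : g \in <[r]> -> base (g x) = base x.
Proof.
move=> /cycleP[k ->]; apply: base_eq; elim: k => [|k IHk].
  by rewrite expg0 perm1 component_refl.
by rewrite expgSr permM permM (component_q fp fq) (component_p fp fq).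
Qed.

Let base_p x : base (p x) = base x.
Proof. by apply: base_eq; rewrite (component_p fp fq) component_refl. Qed.

Let rot_cases x : exists2 g, g \in <[r]> & x = g (base x) \/ x = p (g (base x)).
Proof.
pose S := [set y | [exists g in <[r]>, (y == g (base x)) || (y == p (g (base x)))]].
have : x \in S.
  have: x \in component p q (base x).
    by rewrite (component_eq fp fq (base_in x)) component_refl.
  apply/subsetP/(component_sub fp fq).
  - by rewrite inE; apply/exists_inP; exists 1; rewrite ?group1 // perm1 eqxx.
  - apply/stableP => y; rewrite !inE => /exists_inP[g gr /orP[]/eqP->];
      apply/exists_inP; exists g => //; by rewrite ?fpfK ?eqxx ?orbT.
  apply/stableP => y; rewrite !inE => /exists_inP[g gr /orP[]/eqP->]; apply/exists_inP.
    have hr : (g^-1 * r)^-1 \in <[r]> by rewrite groupV groupM ?groupV.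
    by exists (g^-1 * r)^-1 => //; rewrite q_rot // eqxx orbT.
  have hr : g * r \in <[r]> by rewrite groupM.
  by exists (g * r) => //; rewrite !permM eqxx.
rewrite inE => /exists_inP[g gr xg]; exists g => //.
by case/orP: xg => /eqP; [left | right].
Qed.

(** A point g b, with g a rotation and b its base point, goes to g^-1 b, and p (g b) goes to q (g^-1
    b), so that p is carried to q. The choice of g is immaterial by [rot_inv], the two forms exclude
    each other by [p_notin_rot], and they cover everything by [rot_cases]. *)
Let reflect_fun y : T :=
  if [pick g in <[r]> | g (base y) == y] is Some g then g^-1 (base y)
  else if [pick g in <[r]> | p (g (base y)) == y] is Some g then q (g^-1 (base y))
  else y.

Let rot_inv g h b : g \in <[r]> -> h \in <[r]> -> g b = h b -> g^-1 b = h^-1 b.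
Proof.
by move=> gr hr E; apply: (@perm_inj _ g); rewrite permKV rotC ?groupV // E permK.
Qed.

Let reflect_rot g b : base b = b -> g \in <[r]> -> reflect_fun (g b) = g^-1 b.
Proof.
move=> bb gr; rewrite /reflect_fun base_rot // bb; case: pickP => [h|/(_ g)].
  by move=> /andP[hr /eqP E]; apply: rot_inv.
by rewrite gr eqxx.
Qed.

Let reflect_prot g b : base b = b -> g \in <[r]> -> reflect_fun (p (g b)) = q (g^-1 b).
Proof.
move=> bb gr; rewrite /reflect_fun base_p base_rot // bb; case: pickP => [h|_].
  move=> /andP[hr /eqP]; rewrite p_rot // => /(congr1 g); rewrite permKV -permM => E.
  by have := p_notin_rot b (groupM hr gr); rewrite E eqxx.
case: pickP => [h /andP[hr /eqP/perm_inj E]|/(_ g)]; last by rewrite gr eqxx.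
by congr (q _); apply: rot_inv.
Qed.

Let reflect_p y : reflect_fun (p y) = q (reflect_fun y).
Proof.
have [g gr [->|->]] := rot_cases y.
  by rewrite reflect_prot ?reflect_rot ?base_id.
by rewrite fpfK // reflect_prot ?reflect_rot ?base_id // fpfK.
Qed.

Let reflect_funK : involutive reflect_fun.
Proof.
move=> y; have [g gr [->|->]] := rot_cases y.
  by rewrite !reflect_rot ?groupV ?base_id // invgK.
rewrite reflect_prot ?base_id // q_rot ?groupV // invgK reflect_prot ?base_id //.
  by rewrite invgK permM permM fpfK.
by rewrite groupV groupM.
Qed.

Lemma swap_involutions : exists s : {perm T}, p ^ s = q /\ q ^ s = p.
Proof.
pose s := perm (inv_inj reflect_funK).
have ps : p ^ s = q.
  apply/permP => x; rewrite -[x](permKV s) permJ; move: (s^-1 x) => {}x.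
  by rewrite !permE reflect_p.
exists s; split=> //; rewrite -ps -conjgM.
have -> : s * s = 1 by apply/permP => x; rewrite permM !permE reflect_funK.
by rewrite conjg1.
Qed.
End Swap.

(** * The involution attached to a perfect matching *)

Section Mates.
Variable n : nat.
Implicit Types (P Q : matching n) (x y z : 'I_(2 * n)) (s : 'S_(2 * n)).

Definition mate P x : 'I_(2 * n) :=
  odflt x [pick y | (y != x) && ([set x; y] \in val P)].

Lemma mate_set P x y : ([set x; y] \in val P) = (mate P x == y).
Proof.
case/andP: (valP P) => /and3P[/eqP covP tiP P0] /forallP P2.
have card2 e : e \in val P -> #|e| = 2 by move=> eP; apply/eqP; apply: implyP (P2 e) eP.
have uniqP z z' : [set x; z] \in val P -> [set x; z'] \in val P -> z = z'.
  have H w : [set x; w] \in val P -> pblock (val P) x = [set x; w].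
    by move=> wP; apply: (def_pblock tiP wP); rewrite !inE eqxx.
  move=> zP z'P; have E : [set x; z] = [set x; z'] by rewrite -(H z) ?(H z').
  have := card2 _ zP; rewrite cards2; case: eqP => // /eqP xz _.
  have : z \in [set x; z'] by rewrite -E !inE eqxx orbT.
  by rewrite !inE eq_sym (negPf xz) => /eqP.
have nxx : [set x; x] \notin val P.
  by apply/negP => /card2; rewrite cards2 eqxx.
rewrite /mate; case: pickP => [z /andP[zx zP]|none] /=.
  by apply/idP/eqP => [/(uniqP _ _ zP)|<-].
have /bigcupP[e eP xe] : x \in cover (val P) by rewrite covP inE.
have /eqP/cards2P[a [b [ab eE]]] := card2 _ eP.
have [z zx ez] : exists2 z, z != x & e = [set x; z].
  move: xe; rewrite eE !inE => /orP[]/eqP->; [exists b | exists a] => //.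
    by rewrite eq_sym.
  by rewrite setUC.
by have := none z; rewrite zx -ez eP.
Qed.

Lemma mate_neq P x : mate P x != x.
Proof.
rewrite -mate_set setUid; case/andP: (valP P) => _ /forallP /(_ [set x]).
by apply: contraTN => xP; rewrite xP cards1.
Qed.

Lemma mateK P : involutive (mate P).
Proof. by move=> x; apply/eqP; rewrite -mate_set setUC mate_set. Qed.

Definition mperm P : 'S_(2 * n) := perm (inv_inj (mateK P)).

Lemma mpermE P x y : ([set x; y] \in val P) = (mperm P x == y).
Proof. by rewrite permE mate_set. Qed.

Lemma mperm_fpf P : fpf_involution (mperm P).
Proof. by apply/forallP => x; rewrite !permE mateK mate_neq eqxx. Qed.

Lemma matching_edge P e : e \in val P -> exists x, e = [set x; mperm P x].
Proof.
move=> eP; case/andP: (valP P) => _ /forallP /(_ e) /implyP /(_ eP).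
case/cards2P=> a [b [_ eE]]; exists a; rewrite eE.
by move: eP; rewrite eE mpermE => /eqP->.
Qed.

Lemma mperm_inj : injective mperm.
Proof.
move=> P Q E; apply/val_inj/setP => e; apply/idP/idP => eP;
  have [x ex] := matching_edge eP; by rewrite ex mpermE E.
Qed.

Lemma mperm_surj p : fpf_involution p -> exists P, mperm P = p.
Proof.
move=> fp; pose S := [set [set x; p x] | x : 'I_(2 * n)].
have eS y z : ([set y; z] \in S) = (p y == z).
  apply/imsetP/eqP => [[x _ E]|<-]; last by exists y.
  have yx : y \in [set x; p x] by rewrite -E !inE eqxx.
  have zx : z \in [set x; p x] by rewrite -E !inE eqxx orbT.
  have px : p x \in [set y; z] by rewrite E !inE eqxx orbT.
  have xx : x \in [set y; z] by rewrite E !inE eqxx.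
  move: yx zx px xx; rewrite !inE.
  case/orP => /eqP->; case/orP => /eqP-> //; rewrite ?fpfK //.
    by rewrite orbb (negPf (fpf_neq _ fp)).
  by rewrite orbb eq_sym orbb (negPf (fpf_neq _ fp)).
have S2 e : e \in S -> #|e| = 2.
  by case/imsetP => x _ ->; rewrite cards2 eq_sym fpf_neq.
have PS : is_perfect_matching S.
  apply/andP; split; last by apply/forallP => e; apply/implyP => /S2->.
  apply/and3P; split.
  - apply/eqP/setP => x; rewrite inE; apply/bigcupP; exists [set x; p x].
      by rewrite eS.
    by rewrite !inE eqxx.
  - apply/trivIsetP => _ _ /imsetP[x _ ->] /imsetP[y _ ->]; apply: contraR.
    case/pred0Pn => z /andP[] /=; rewrite !inE => zx zy.
    suff aux w : (z == w) || (z == p w) -> [set w; p w] = [set z; p z].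
      by rewrite (aux x) // (aux y).
    by case/orP => /eqP->; rewrite // fpfK // setUC.
  by apply/negP => /S2; rewrite cards0.
exists (exist _ S PS); apply/permP => x; apply/eqP; by rewrite -mpermE /= eS.
Qed.

Lemma mperm_act P s : mperm (matching_act P s) = (mperm P ^ s)%g.
Proof.
apply/permP => x; rewrite -[x](permKV s) permJ; move: (s^-1 x)%g => {}x.
apply/eqP; rewrite -mpermE /=; apply/imsetP.
exists [set x; mperm P x]; first by rewrite mpermE.
by rewrite imsetU !imset_set1.
Qed.

Lemma union_adjE P Q x y :
  union_adj P Q x y = (y == mperm P x) || (y == mperm Q x).
Proof.
rewrite /union_adj inE !mpermE (eq_sym y (mperm P x)) (eq_sym y (mperm Q x)).
have [->|//] := eqVneq x y.
by rewrite !(negPf (fpf_neq _ (mperm_fpf _))).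
Qed.

End Mates.

(** * Specht modules *)

Section Tableaux.
Variables (m : nat) (nu : seq nat).
Hypothesis nu_sum : sumn nu = m.
Implicit Types (x y z : 'I_m) (t s q : 'S_m).

Local Notation row := (reshape_index nu).
Local Notation col := (reshape_offset nu).

Lemma cell_lt x : (x < sumn nu)%N. Proof. by rewrite nu_sum. Qed.

Lemma cell_inj x y : row x = row y -> col x = col y -> x = y.
Proof.
move=> rxy cxy; apply: val_inj.
by rewrite /= -[LHS](reshape_indexK nu) -[RHS](reshape_indexK nu) rxy cxy.
Qed.

Lemma cell_exists i k : (k < nth 0 nu i)%N -> exists x, row x = i /\ col x = k.
Proof.
move=> ki; have := flatten_indexP ki; rewrite nu_sum => ltm.
by exists (Ordinal ltm); rewrite /= flatten_indexKl // flatten_indexKr.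
Qed.

Lemma mem_tabloid t (i : 'I_(size nu)) y : (y \in tabloid nu t i) = (row ((t^-1)%g y) == i).
Proof.
rewrite ffunE; apply/imsetP/idP => [[x + ->]|yi]; first by rewrite inE permK.
by exists ((t^-1)%g y); rewrite ?inE ?permKV.
Qed.

Lemma tabloid_eqP t s :
  reflect (forall y, row ((t^-1)%g y) = row ((s^-1)%g y)) (tabloid nu t == tabloid nu s).
Proof.
apply: (iffP eqP) => [E y|E].
  have lt_r := reshape_indexP (cell_lt ((t^-1)%g y)).
  have : y \in tabloid nu t (Ordinal lt_r) by rewrite mem_tabloid.
  by rewrite E mem_tabloid => /eqP.
by apply/ffunP => i; apply/setP => y; rewrite !mem_tabloid E.
Qed.

Lemma column_stabilizerP t q :
  reflect (forall y, col ((t^-1)%g (q y)) = col ((t^-1)%g y)) (q \in column_stabilizer nu t).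
Proof. by rewrite inE; apply: (iffP forallP) => H y; apply/eqP. Qed.

Lemma column_stabilizer1 t : 1%g \in column_stabilizer nu t.
Proof. by apply/column_stabilizerP => y; rewrite perm1. Qed.

Lemma column_stabilizerM t q s : q \in column_stabilizer nu t ->
  ((q * s)%g \in column_stabilizer nu t) = (s \in column_stabilizer nu t).
Proof.
move=> /column_stabilizerP qt; apply/column_stabilizerP/column_stabilizerP => H y.
  have := H ((q^-1)%g y); rewrite permM permKV => ->.
  by rewrite -[in RHS](permKV q y) qt.
by rewrite permM H qt.
Qed.

Lemma column_stabilizer_tperm t y z : col ((t^-1)%g y) = col ((t^-1)%g z) ->
  tperm y z \in column_stabilizer nu t.
Proof. by move=> yz; apply/column_stabilizerP => x; case: tpermP => // ->. Qed.

Lemma column_stabilizer_translate t q : q \in column_stabilizer nu t ->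
  column_stabilizer nu (t * q)%g = column_stabilizer nu t.
Proof.
move=> qt; have qtV : q^-1%g \in column_stabilizer nu t.
  by rewrite -(column_stabilizerM _ qt) mulgV column_stabilizer1.
move/column_stabilizerP: qtV => qtV; apply/setP => s.
by apply/column_stabilizerP/column_stabilizerP => H y; have := H y;
  rewrite !invMg !permM !qtV.
Qed.

Lemma tabloid_column_inj t q s :
  q \in column_stabilizer nu t -> s \in column_stabilizer nu t ->
  tabloid nu (t * q) = tabloid nu (t * s) -> q = s.
Proof.
move=> qt st /eqP/tabloid_eqP E; apply: invg_inj; apply/permP => y.
apply: (@perm_inj _ (t^-1)%g); apply: cell_inj; first by have := E y; rewrite !invMg !permM.
move/column_stabilizerP: qt => /(_ ((q^-1)%g y)); rewrite permKV => <-.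
by move/column_stabilizerP: st => /(_ ((s^-1)%g y)); rewrite permKV => <-.
Qed.

Hypothesis nu_sorted : sorted geq nu.

(* A filling whose columns lie in distinct rows of s uses each row of the
   diagram at most as often, column by column, as the diagram itself, and both
   have the same total in the first i rows; so equality holds throughout. *)
Lemma column_transversal t s :
  (forall y z, y != z -> col ((t^-1)%g y) = col ((t^-1)%g z) ->
     row ((s^-1)%g y) != row ((s^-1)%g z)) ->
  exists2 q, q \in column_stabilizer nu t & tabloid nu s = tabloid nu (t * q)%g.
Proof.
move=> trans.
pose R y := row ((s^-1)%g y); pose K y := col ((t^-1)%g y).
pose a i k := #|[set y | (R y < i)%N & K y == k]|.
pose b i k := #|[set x : 'I_m | (row x < i)%N & col x == k]|.
have Kcard k : #|[set y | K y == k]| = #|[set x : 'I_m | col x == k]|.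
  rewrite -(card_imset _ (@perm_inj _ (t^-1)%g)); apply: eq_card => x.
  by rewrite -[x](permK t) (mem_imset _ _ (@perm_inj _ (t^-1)%g)) !inE /K permK.
have Rcard i : #|[set y | (R y < i)%N]| = #|[set x : 'I_m | (row x < i)%N]|.
  rewrite -(card_imset _ (@perm_inj _ (s^-1)%g)); apply: eq_card => x.
  by rewrite -[x](permK s) (mem_imset _ _ (@perm_inj _ (s^-1)%g)) !inE /R permK.
have le_ab i k : (a i k <= b i k)%N.
  (* If column k reaches row i or below, then it meets all of the first i rows, so [b i k] is at
     least i, while [a i k] is at most i because the rows involved are distinct. Otherwise [b i k]
     counts the whole column k. *)
  have [/existsP[x0 /andP[/eqP x0k x0i]]|/existsPn none] :=
      boolP [exists x : 'I_m, (col x == k) && (i <= row x)%N].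
    have cells (j : 'I_i) : exists x : 'I_m, (row x == j) && (col x == k).
      suff /cell_exists[x [<- <-]] : (k < nth 0 nu j)%N by exists x; rewrite !eqxx.
      have := reshape_offsetP (cell_lt x0); rewrite x0k => /leq_trans; apply.
      have geq_tr : transitive geq by move=> ? ? ? /= xy yz; apply: leq_trans yz xy.
      apply: (sorted_leq_nth geq_tr (fun n => leqnn n) 0 nu_sorted).
      - by apply: leq_ltn_trans (reshape_indexP (cell_lt x0)); apply: ltnW (leq_trans _ x0i).
      - exact: reshape_indexP (cell_lt x0).
      - exact: ltnW (leq_trans _ x0i).
    have [f f_ok] : exists f : 'I_i -> 'I_m, forall j, row (f j) = j /\ col (f j) = k.
      exists (fun j => xchoose (cells j)) => j.
      by have /andP[/eqP ? /eqP ?] := xchooseP (cells j).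
    have f_inj : injective f.
      by move=> j j' E; apply: val_inj; rewrite /= -(f_ok j).1 E (f_ok j').1.
    apply: (@leq_trans i).
      have UR : uniq [seq R y | y <- enum [set y | (R y < i)%N & K y == k]].
        rewrite map_inj_in_uniq ?enum_uniq // => y z; rewrite !mem_enum !inE.
        move=> /andP[_ /eqP Ky] /andP[_ /eqP Kz] Ryz; apply/eqP/negPn/negP => yz.
        by have := trans y z yz; rewrite -/(K y) -/(K z) -/(R y) -/(R z) Ky Kz Ryz eqxx
          => /(_ erefl).
      have sub : {subset [seq R y | y <- enum [set y | (R y < i)%N & K y == k]] <= iota 0 i}.
        move=> _ /mapP[y + ->]; rewrite mem_enum inE mem_iota => /andP[Ryi _].
        by rewrite add0n Ryi.
      by have := uniq_leq_size UR sub; rewrite size_map -cardE size_iota.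
    apply: (@leq_trans #|codom f|); first by rewrite card_codom ?card_ord.
    apply: subset_leq_card.
    apply/subsetP => _ /codomP[j ->]; have [rj cj] := f_ok j.
    by rewrite inE rj cj ltn_ord eqxx.
  apply: (@leq_trans #|[set y | K y == k]|).
    by apply: subset_leq_card; apply/subsetP => y; rewrite !inE => /andP[].
  rewrite Kcard; apply: subset_leq_card; apply/subsetP => x; rewrite !inE => xk.
  by have := none x; rewrite xk /= ltnNge => ->.
have col_lt x : (col x < m)%N by apply: leq_ltn_trans (leq_subr _ _) (ltn_ord x).
have suma i : (\sum_(k < m) a i k = #|[set y | (R y < i)%N]|)%N.
  rewrite -[RHS]sum1_card [RHS](partition_big (fun y => Ordinal (col_lt ((t^-1)%g y))) xpredT) //=.
  by apply: eq_bigr => k _; rewrite /a -sum1_card; apply: eq_bigl => y; rewrite !inE -val_eqE.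
have sumb i : (\sum_(k < m) b i k = #|[set x : 'I_m | (row x < i)%N]|)%N.
  rewrite -[RHS]sum1_card [RHS](partition_big (fun x => Ordinal (col_lt x)) xpredT) //=.
  by apply: eq_bigr => k _; rewrite /b -sum1_card; apply: eq_bigl => x; rewrite !inE -val_eqE.
have ab i (k : 'I_m) : a i k = b i k.
  have := etrans (suma i) (etrans (Rcard i) (esym (sumb i))).
  rewrite (bigD1 k) //= [in RHS](bigD1 k) //= => E; apply/eqP; rewrite eqn_leq le_ab /=.
  have le : (\sum_(j < m | j != k) a i j <= \sum_(j < m | j != k) b i j)%N.
    by apply: leq_sum => j _; apply: le_ab.
  move: E le; set X := (\sum_(j < m | _) a i j)%N; set Y := (\sum_(j < m | _) b i j)%N; lia.
(* The entry y makes [a] grow strictly from [R y] to its successor in column [K y]. By equality so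
   does [b], which means that the diagram has a cell in this row and column. *)
have cellP y : exists x : 'I_m, (row x == R y) && (col x == K y).
  pose k := Ordinal (col_lt ((t^-1)%g y)); apply/existsP; apply: contraT => /existsPn none; exfalso.
  have E1 := ab (R y).+1 k; have E2 := ab (R y) k.
  have : (a (R y) k < a (R y).+1 k)%N.
    apply: proper_card; apply/properP; split.
      by apply/subsetP => z; rewrite !inE => /andP[/ltnW H ->]; rewrite ltnS H.
    by exists y; rewrite !inE ?ltnn // ltnS leqnn eqxx.
  rewrite E1 E2 ltnNge => /negP; apply; apply: subset_leq_card; apply/subsetP => x.
  rewrite !inE ltnS => /andP[xR xK]; rewrite xK andbT ltn_neqAle xR andbT.
  by apply: contraNneq (none x) => ->; rewrite eqxx xK.
have [f f_ok] : exists f : 'I_m -> 'I_m, forall y, row (f y) = R y /\ col (f y) = K y.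
  exists (fun y => xchoose (cellP y)) => y.
  by have /andP[/eqP ? /eqP ?] := xchooseP (cellP y).
have g_inj : injective (t \o f).
  move=> y z /perm_inj E; apply/eqP/negPn/negP => yz; have := trans y z yz.
  rewrite -/(K y) -/(K z) -/(R y) -/(R z) -(f_ok y).1 -(f_ok y).2 -(f_ok z).1 -(f_ok z).2.
  by rewrite E eqxx => /(_ erefl).
have gE y : perm g_inj y = t (f y) by rewrite permE.
have gt : perm g_inj \in column_stabilizer nu t.
  by apply/column_stabilizerP => z; rewrite gE permK (f_ok z).2.
exists (perm g_inj)^-1%g.
  by rewrite -(column_stabilizerM _ gt) mulgV column_stabilizer1.
apply/eqP/tabloid_eqP => y; rewrite invMg invgK permM gE permK.
by rewrite (f_ok y).1.
Qed.

End Tableaux.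

Local Open Scope ring_scope.

(** * The case of ten points *)

(* 8 d_i times the i-th zonal spherical function of S_10, where d_i is the
   dimension of its Specht module; these are the eigenvectors of
   [transposition_table], and 7560 = 8 * 945 normalizes them to idempotents. *)
Definition zonal_table : seq (seq int) :=
  [:: [::    8;    8;    8;    8;    8;    8;    8];
      [::  280;  154;   91;   28;   28; - 35; - 35];
      [::  720;  216; - 36;  132; - 78;   90; - 15];
      [:: 1800;  270;   45; - 300; - 60; - 45;   75];
      [:: 2016;    0; - 252;  168;   84; - 126;   21];
      [:: 2400; - 480;   60; - 120;   60;  150; - 75];
      [::  336; - 168;   84;   84; - 42; - 42;   21]]%Z.

Definition zonal_num (i m : nat) : int := nth 0 (nth [::] zonal_table i) m.

Definition zonal (i m : nat) : algC := (zonal_num i m)%:~R / 7560.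

(** For lambda = [5], [4,1], [3,2], [3,1,1], [2,2,1], [2,1,1,1], [1^5] in this order, the value is
    10 plus twice the sum of the contents of 2 lambda: sums run over ordered pairs of points,
    including the ten diagonal ones. *)
Definition transposition_eigenvalue (i : nat) : int :=
  nth 0 [:: 100; 64; 44; 32; 20; 4; - 20]%Z i.

(** This is 384, the number of matchings forming a ten-cycle with a given one, times the ratio of
    the last to the first entry of row i of [zonal_table]. *)
Definition related_eigenvalue (i : nat) : int :=
  nth 0 [:: 384; - 48; - 8; 16; 4; - 12; 24]%Z i.

Lemma all_iotaP n (P : pred nat) : all P (iota 0 n) -> forall i, (i < n)%N -> P i.
Proof. by move=> /allP allP i lti; apply: allP; rewrite mem_iota. Qed.

Lemma zonal_eigen i r : (i < 7)%N -> (r < 7)%N ->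
  \sum_(m < 7) zonal i m *+ nth 0%N (nth [::] transposition_table r) m
    = (transposition_eigenvalue i)%:~R * zonal i r.
Proof.
move=> i7 r7; rewrite /zonal mulrA -intrM.
under eq_bigr => m _ do rewrite -mulrnAl -rmorphMn.
rewrite -mulr_suml -rmorph_sum; congr (_%:~R / _).
rewrite !big_ord_recl big_ord0 /=; apply/eqP; move: r r7; apply: all_iotaP.
by move: i i7; apply: all_iotaP; vm_compute.
Qed.

Lemma zonal_sum r : (r < 7)%N -> \sum_(i < 7) zonal i r = (r == 0%N)%:R.
Proof.
move=> r7; rewrite /zonal -mulr_suml -rmorph_sum.
suff -> : \sum_(i < 7) zonal_num i r = (r == 0%N)%:R * 7560.
  by rewrite /= rmorphM /= !rmorph_nat mulfK ?pnatr_eq0.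
rewrite !big_ord_recl big_ord0 /=; apply/eqP; move: r r7; apply: all_iotaP.
by vm_compute.
Qed.

Lemma zonal_related r : (r < 7)%N ->
  \sum_(i < 7) (related_eigenvalue i)%:~R * zonal i r = (r == 6%N)%:R.
Proof.
move=> r7; rewrite /zonal; under eq_bigr => i _ do rewrite mulrA -intrM.
rewrite -mulr_suml -rmorph_sum.
suff -> : \sum_(i < 7) related_eigenvalue i * zonal_num i r = (r == 6%N)%:R * 7560.
  by rewrite /= rmorphM /= !rmorph_nat mulfK ?pnatr_eq0.
rewrite !big_ord_recl big_ord0 /=; apply/eqP; move: r r7; apply: all_iotaP.
by vm_compute.
Qed.

Section TenPointsSpectrum.
Variables (T : finType) (p0 : {perm T}) (V : {set T}).
Hypotheses (fp0 : fpf_involution p0) (pV : stable p0 V) (cV : #|V| = 10%N).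
Implicit Types (p q r : {perm T}).

Local Notation M := (family p0 V).

Definition kernel i p q := zonal i (rel_type p q).

Lemma family_rel_type p q : p \in M -> q \in M ->
  (rel_type p q < 7)%N /\
  forall w : nat -> algC,
    \sum_(x in V) \sum_(y in V) w (rel_type p (q ^ tperm x y)%g)
    = \sum_(m < 7) w m *+ nth 0%N (nth [::] transposition_table (rel_type p q)) m.
Proof.
move=> pM qM; have fp := family_fpf pM; have ppV := family_stable fp0 pV pM.
rewrite -(family_eq pM) in qM.
have [s [Us ss sV sp]] := @adapted_enum _ _ _ 5 fp ppV cV.
have [x0 _] : exists x, x \in V by apply/card_gt0P; rewrite cV.
split; first exact: (rel_type_lt fp ppV Us ss sV (sp x0) qM).
by move=> w; rewrite (transposition_row_sum fp ppV Us ss sV (sp x0) w qM).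
Qed.

Lemma family_tperm p x y : x \in V -> y \in V -> ((p ^ tperm x y)%g \in M) = (p \in M).
Proof.
move=> xV yV; have tM q : q \in M -> (q ^ tperm x y)%g \in M.
  by apply: family_conj => //; apply: tperm_id_off.
by apply/idP/idP => /tM //; rewrite -conjgM tperm2 conjg1.
Qed.

Lemma reindex_tperm x y (F : {perm T} -> algC) : x \in V -> y \in V ->
  \sum_(q in M) F (q ^ tperm x y)%g = \sum_(q in M) F q.
Proof.
move=> xV yV; rewrite [RHS](reindex_inj (conjg_inj (tperm x y))) /=.
by apply: eq_bigl => q; rewrite family_tperm.
Qed.

Lemma kernel_sym i p q : kernel i p q = kernel i q p.
Proof. by rewrite /kernel rel_type_sym. Qed.

Lemma kernel_eigen i p q : (i < 7)%N -> p \in M -> q \in M ->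
  \sum_(x in V) \sum_(y in V) kernel i p (q ^ tperm x y)%g
    = (transposition_eigenvalue i)%:~R * kernel i p q.
Proof.
move=> i7 pM qM; have [r7 ->] := family_rel_type pM qM; exact: zonal_eigen.
Qed.

(** Every transposition permutes the family, so after summation over q the transposition operator
    multiplies by 100, the number of ordered pairs of points. Only the index 0 has this
    eigenvalue. *)
Lemma kernel_sum i : (0 < i < 7)%N -> forall p, p \in M -> \sum_(q in M) kernel i p q = 0.
Proof.
move=> /andP[i0 i7] p pM.
have : (transposition_eigenvalue i)%:~R * (\sum_(q in M) kernel i p q)
     = 100%:R * \sum_(q in M) kernel i p q.
  rewrite mulr_sumr.
  under eq_bigr => q qM do rewrite -kernel_eigen //.
  rewrite exchange_big /=; under eq_bigr => x xV.
    rewrite exchange_big /=; under eq_bigr => y yV do rewrite (reindex_tperm (kernel i p)) //.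
    over.
  by rewrite !sumr_const cV -mulrnA mulr_natl.
move/eqP; rewrite -subr_eq0 -mulrBl mulf_eq0 => /orP[|/eqP//].
rewrite (_ : 100%:R = (100%:Z)%:~R) // -intrB intr_eq0.
by case: i i0 i7 => [|[|[|[|[|[|[|//]]]]]]].
Qed.

Lemma kernel_total p q : p \in M -> q \in M ->
  \sum_(k < 7) kernel k p q = (p == q)%:R.
Proof.
move=> pM qM; have [r7 _] := family_rel_type pM qM; rewrite zonal_sum //.
congr (nat_of_bool _)%:R; apply/eqP/eqP => [|->]; last first.
  rewrite /rel_type /diff_card /square_card.
  rewrite (_ : [set x | q x != q x] = set0); last by apply/setP => x; rewrite !inE eqxx.
  rewrite (_ : [set x | _ & _] = set0) ?cards0 //.
  by apply/setP => x; rewrite !inE eqxx.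
have d0_of d t : type_index d t = 0%N -> d = 0%N by case: d.
move/d0_of/eqP; rewrite cards_eq0 => /eqP/setP d0; apply/permP => x.
by apply/eqP; have := d0 x; rewrite !inE => /negPn.
Qed.

(* Kernels are invariant under relabelling, hence commute with the transposition
   operator, which has different eigenvalues on kernels i and j; and since the
   kernels sum to the identity, they are idempotent. *)
Lemma kernel_comp i j p r : (i < 7)%N -> (j < 7)%N -> p \in M -> r \in M ->
  \sum_(q in M) kernel i p q * kernel j q r = (i == j)%:R * kernel i p r.
Proof.
move=> i7 j7 pM rM.
have orth k l : (k < 7)%N -> (l < 7)%N -> k != l ->
    \sum_(q in M) kernel k p q * kernel l q r = 0.
  move=> k7 l7 kl.
  have : (transposition_eigenvalue k)%:~R * \sum_(q in M) kernel k p q * kernel l q r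
     = (transposition_eigenvalue l)%:~R * \sum_(q in M) kernel k p q * kernel l q r.
    rewrite !mulr_sumr.
    transitivity (\sum_(x in V) \sum_(y in V)
      \sum_(q in M) kernel k p (q ^ tperm x y)%g * kernel l q r).
      under [RHS]eq_bigr => x xV do rewrite exchange_big.
      rewrite [RHS]exchange_big; apply: eq_bigr => q qM.
      rewrite mulrA -kernel_eigen // mulr_suml; apply: eq_bigr => x xV.
      by rewrite mulr_suml.
    transitivity (\sum_(x in V) \sum_(y in V)
      \sum_(q in M) kernel k p q * kernel l r (q ^ tperm x y)%g).
      apply: eq_bigr => x xV; apply: eq_bigr => y yV.
      rewrite -(reindex_tperm (fun q => kernel k p q * kernel l r (q ^ tperm x y)%g) xV yV).
      by apply: eq_bigr => q qM; rewrite -conjgM tperm2 conjg1 [kernel l r _]kernel_sym.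
    under eq_bigr => x xV do rewrite exchange_big.
    rewrite exchange_big; apply: eq_bigr => q qM.
    rewrite mulrCA [kernel l q r]kernel_sym -kernel_eigen // mulr_sumr.
    by apply: eq_bigr => x xV; rewrite mulr_sumr.
  move/eqP; rewrite -subr_eq0 -mulrBl mulf_eq0 => /orP[|/eqP//].
  rewrite -intrB intr_eq0.
  by case: k k7 kl => [|[|[|[|[|[|[|//]]]]]]] _;
     case: l l7 => [|[|[|[|[|[|[|//]]]]]]].
have [<-|ij] := eqVneq i j; last by rewrite mul0r orth.
rewrite mul1r.
have <- : \sum_(q in M) kernel i p q * (\sum_(k < 7) kernel k q r) = kernel i p r.
  rewrite (bigD1 r) //= kernel_total // eqxx mulr1 [X in _ + X]big1 ?addr0 //.
  by move=> q /andP[qM /negPf qr]; rewrite kernel_total // qr mulr0.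
under [RHS]eq_bigr => q _ do rewrite mulr_sumr.
rewrite exchange_big (bigD1 (Ordinal i7)) //= [X in _ + X]big1 ?addr0 // => k.
by rewrite -val_eqE eq_sym => ki; rewrite orth.
Qed.

Lemma related_rel_type p q : related p q = (rel_type p q == 6%N).
Proof.
have -> : related p q = (diff_card p q == 10%N) && (square_card p q == 0%N).
  congr (_ && _); rewrite cards_eq0; apply/forallP/eqP => [H|/setP H x].
    apply/setP => x; rewrite !inE; apply/negP => /andP[/(implyP (H x))].
    by move=> /negPf ->.
  by have := H x; rewrite !inE; case: eqP => //= _ /negbT.
rewrite /rel_type /type_index /=.
case: (diff_card p q) => [|[|[|[|[|[|[|[|[|[|[|d]]]]]]]]]]];
  case: (square_card p q) => [|[|[|[|[|[|[|[|[|t]]]]]]]]] //.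
Qed.

Lemma kernel_related p q : p \in M -> q \in M ->
  \sum_(i < 7) (related_eigenvalue i)%:~R * kernel i p q = (related p q)%:R.
Proof.
move=> pM qM; have [r7 _] := family_rel_type pM qM.
by rewrite zonal_related // related_rel_type.
Qed.

Lemma kernel_real i p q : (kernel i p q)^* = kernel i p q.
Proof. by rewrite /kernel /zonal fmorph_div rmorph_int rmorph_nat. Qed.

(** Summing the spectral decomposition [kernel_related] over q kills every kernel but the constant
    one, whose value is 1/945 on each of the 945 matchings. *)
Lemma card_related_ten p : p \in M -> #|[set q in M | related p q]| = 384%N.
Proof.
move=> pM; apply/eqP; rewrite -(eqr_nat algC) -sum1_card natr_sum; apply/eqP.
transitivity (\sum_(q in M) (related p q)%:R : algC).
  under [RHS]eq_bigr => q _ do rewrite mulrb.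
  by rewrite -big_mkcondr; apply: eq_bigl => q; rewrite inE.
under eq_bigr => q qM do rewrite -kernel_related //.
rewrite exchange_big /=; under eq_bigr => i _ do rewrite -mulr_sumr.
rewrite big_ord_recl [X in _ + X]big1 ?addr0 => [|i _]; last first.
  by rewrite kernel_sum ?mulr0 // lift0 /= ltnS ltn_ord.
have k0 q : q \in M -> kernel 0 p q = (945%:R)^-1.
  move=> qM; have [r7 _] := family_rel_type pM qM; rewrite /kernel /zonal /zonal_num.
  have -> : nth 0 (nth [::] zonal_table 0) (rel_type p q) = 8.
    by case: (rel_type p q) r7 => [|[|[|[|[|[|[|//]]]]]]].
  have -> : 7560 = 8%:R * 945%:R :> algC by rewrite -natrM.
  by rewrite rmorph_nat invfM mulVKf ?pnatr_eq0.
rewrite (eq_bigr _ k0) sumr_const (@card_family _ _ _ 5) // (_ : odd_fact 5 = 945%N) //.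
by rewrite -[X in _ * X]mulr_natl mulfV ?pnatr_eq0 // mulr1 /= -pmulrn.
Qed.

Definition energy (M' : {set {perm T}}) (f : {perm T} -> algC) : algC :=
  \sum_(p in M') \sum_(q in M') (related p q)%:R * (f q * (f p)^*).

(** The kernels are real, symmetric and idempotent, so each form [S i] is a sum of squares; [S 0]
    vanishes because f sums to zero. The remaining coefficients are at most 24, and 32 is the
    constant for which the passage to twelve points is exact. *)
Lemma energy_ten (f : {perm T} -> algC) : \sum_(p in M) f p = 0 ->
  energy M f <= 32%:R * \sum_(p in M) `|f p| ^+ 2.
Proof.
move=> f0.
pose S i := \sum_(p in M) \sum_(q in M) kernel i p q * (f q * (f p)^*).
have S_ge0 i : (i < 7)%N -> 0 <= S i.
  move=> i7.
  suff -> : S i = \sum_(r in M) `|\sum_(q in M) kernel i r q * f q| ^+ 2.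
    by apply: sumr_ge0 => r _; rewrite exprn_ge0.
  have comp p q : p \in M -> q \in M ->
      kernel i p q = \sum_(r in M) kernel i p r * kernel i r q.
    by move=> pM qM; rewrite kernel_comp // eqxx mul1r.
  rewrite /S; under [LHS]eq_bigr => p pM do under eq_bigr => q qM do
    rewrite comp // mulr_suml.
  under [LHS]eq_bigr => p pM do rewrite exchange_big /=.
  rewrite exchange_big /=; apply: eq_bigr => r rM.
  rewrite normCK rmorph_sum /= mulrC mulr_suml; apply: eq_bigr => p pM.
  rewrite mulr_sumr; apply: eq_bigr => q qM.
  rewrite rmorphM /= kernel_real [kernel i r p]kernel_sym.
  move: (kernel i p r) (kernel i r q) (f q) (f p)^* => a b c d.
  by rewrite -!mulrA; congr (_ * _); rewrite [LHS]mulrA [LHS]mulrC.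
have S00 : S 0%N = 0.
  rewrite /S big1 // => p pM.
  have k0 q : q \in M -> kernel 0 p q = 8 / 7560.
    move=> qM; have [r7 _] := family_rel_type pM qM; rewrite /kernel /zonal /zonal_num.
    by case: (rel_type p q) r7 => [|[|[|[|[|[|[|//]]]]]]].
  under eq_bigr => q qM do rewrite k0 //.
  by rewrite -mulr_sumr -mulr_suml f0 mul0r mulr0.
have -> : energy M f = \sum_(i < 7) (related_eigenvalue i)%:~R * S i.
  rewrite /energy /S; under [RHS]eq_bigr => i _ do rewrite mulr_sumr.
  rewrite [RHS]exchange_big; apply: eq_bigr => p pM.
  under [RHS]eq_bigr => i _ do rewrite mulr_sumr.
  rewrite [RHS]exchange_big; apply: eq_bigr => q qM.
  rewrite -kernel_related // mulr_suml; apply: eq_bigr => i _; exact: esym (mulrA _ _ _).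
have -> : \sum_(p in M) `|f p| ^+ 2 = \sum_(i < 7) S i.
  rewrite /S exchange_big; apply: eq_bigr => p pM.
  rewrite exchange_big (bigD1 p) //= [X in _ + X]big1 ?addr0 => [|q /andP[qM qp]].
    by rewrite -mulr_suml kernel_total // eqxx mul1r normCK.
  by rewrite -mulr_suml kernel_total // eq_sym (negPf qp) mul0r.
rewrite mulr_sumr ler_sum // => i _.
case: i => -[|i] i7 /=; first by rewrite S00 !mulr0.
rewrite ler_wpM2r ?S_ge0 // (_ : 32%:R = (32%:Z)%:~R) // ler_int.
by case: i i7 => [|[|[|[|[|[|//]]]]]].
Qed.
End TenPointsSpectrum.

(** * The second eigenvalue *)

Section Counting.
Variable T : finType.
Implicit Types (p q r s : {perm T}) (V : {set T}) (x y u v : T).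

Lemma card_common p q V : q \in family p V -> related p q ->
  (#|[set u in V | q u == p u]| + 10)%N = #|V|.
Proof.
case/familyP=> fq eqp /andP[/eqP d10 _].
rewrite -(cardsID [set x | p x != q x] V) addnC; congr (_ + _)%N.
  rewrite -d10 (setIidPr _) //; apply/subsetP => x; rewrite inE.
  by apply: contraR => xV; rewrite eqp // inE.
by apply: eq_card => x; rewrite !inE negbK eq_sym andbC.
Qed.

Lemma set_edge_related p V u : fpf_involution p -> stable p V ->
  [set q in family p V | related p q & q u == p u]
    = [set q in family p (V :\: [set u; p u]) | related p q].
Proof.
move=> fp pV; rewrite -(family_edge u fp pV (family_refl V fp)).
apply/setP => q; rewrite in_set [RHS]in_set in_set.
by rewrite -andbA [(q u == _) && _]andbC.
Qed.

Lemma sum_related_edge p V : fpf_involution p -> stable p V ->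
  (\sum_(u in V) #|[set q in family p V | related p q & q u == p u]|
   = #|[set q in family p V | related p q]| * (#|V| - 10))%N.
Proof.
move=> fp pV; rewrite -sum_nat_const.
under eq_bigr => u uV do rewrite -sum1_card.
rewrite (exchange_big_dep (mem [set q in family p V | related p q])) /=; last first.
  by move=> u q uV; rewrite !in_set => /and3P[-> -> _].
apply: eq_bigr => q; rewrite in_set => /andP[qF pq].
rewrite -(card_common qF pq) addnK -sum1_card; apply: eq_bigl => u.
by move: qF; rewrite !in_set pq => ->.
Qed.

(** The binomial coefficient chooses the five edges of p to be replaced. The induction counts pairs
    of a related q and a point where q agrees with p: each q has |V| - 10 such points, and fixing
    one of them removes an edge. *)
Lemma card_related p V n : fpf_involution p -> stable p V ->
  #|V| = (2 * (n + 5))%N ->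
  #|[set q in family p V | related p q]| = (384 * 'C(n + 5, 5))%N.
Proof.
elim: n => [|n IHn] in V * => fp pV cV.
  by rewrite (card_related_ten fp pV cV) ?family_refl // binn.
have := sum_related_edge fp pV.
under eq_bigr => u uV.
  rewrite set_edge_related // IHn ?stableD //; last exact: cardsD_edge cV.
  over.
rewrite sum_nat_const cV => H; apply/eqP.
have n0 : (0 < 2 * n.+1)%N by [].
rewrite -(eqn_pmul2r n0); move: H; rewrite (_ : 2 * (n.+1 + 5) - 10 = 2 * n.+1)%N; last first.
  by rewrite mulnDr addnK.
move=> <-; apply/eqP; have := mul_bin_down (n.+1 + 5) 5; rewrite addnK addSn /= => E.
transitivity (768 * ((n + 5).+1 * 'C(n + 5, 5)))%N; first by ring.
by rewrite E; ring.
Qed.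

Lemma card_related_edge p V u n : fpf_involution p -> stable p V -> u \in V ->
  #|V| = (2 * (n + 5))%N ->
  #|[set q in family p V | related p q & q u == p u]| = (384 * 'C(n + 4, 5))%N.
Proof.
case: n => [|n] fp pV uV cV.
  rewrite bin_small // muln0; apply/eqP; rewrite cards_eq0; apply/eqP/setP => q.
  rewrite in_set in_set0; apply/negP => /and3P[qF pq quE].
  have := card_common qF pq; rewrite cV => /eqP; rewrite -[X in _ == X]add0n eqn_add2r.
  by rewrite cards_eq0 => /eqP/setP/(_ u); rewrite !inE uV quE.
rewrite set_edge_related // (@card_related _ _ n) ?stableD //.
  by rewrite addSnnS.
exact: cardsD_edge cV.
Qed.

Lemma edge_flip p v : fpf_involution p -> (p ^ tperm v (p v))%g = p.
Proof.
move=> fp; apply/permP => x; rewrite -[x](permKV (tperm v (p v))) permJ.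
move: ((tperm v (p v))^-1 x)%g => {}x.
have [->|xv] := eqVneq x v; first by rewrite tpermL tpermR fpfK.
have [->|xpv] := eqVneq x (p v); first by rewrite tpermR fpfK // tpermL.
rewrite [tperm v (p v) x]tpermD 1?eq_sym // tpermD // 1?eq_sym ?(inj_eq perm_inj) //.
by rewrite fpf_eqC // eq_sym.
Qed.

(** Conjugation by a permutation that centralizes p, fixes u and all points off V, and sends v to w
    maps one set onto the other. It exchanges the edges of v and w, or flips their common edge when
    w = p v. *)
Lemma card_related_nonedge_const p V u v w : fpf_involution p -> stable p V ->
  v \in V -> w \in V -> v != u -> v != p u -> w != u -> w != p u ->
  #|[set q in family p V | related p q & q u == v]|
    = #|[set q in family p V | related p q & q u == w]|.
Proof.
move=> fp pV vV wV vu vpu wu wpu.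
have [s [ps sv su sV]] : exists s, [/\ (p ^ s)%g = p, s v = w, s u = u
    & {in ~: V, s =1 id}].
  have [wE|wpv] := eqVneq w (p v).
    exists (tperm v (p v)); split; rewrite ?edge_flip ?tpermL //.
      by rewrite tpermD // fpf_eqC // eq_sym.
    by apply: tperm_id_off; rewrite ?stableE.
  have [ps sv sx] := edge_swap fp wpv; exists (tperm v w * tperm (p v) (p w))%g.
  split=> //.
    apply: sx; rewrite 1?eq_sym //; first by rewrite fpf_eqC // eq_sym.
    by rewrite fpf_eqC // eq_sym.
  move=> x xV; apply: sx; apply: contraTneq xV => ->; rewrite inE negbK ?stableE //.
rewrite -(card_imset _ (conjg_inj s)); apply: eq_card => q.
rewrite -[q](conjgKV s) (mem_imset _ _ (conjg_inj s)); move: (q ^ s^-1)%g => {}q.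
rewrite [LHS]in_set [RHS]in_set.
have -> : ((q ^ s)%g \in family p V) = (q \in family p V).
  apply/idP/idP => qF; last exact: family_conj.
  rewrite -[q](conjgK s); apply: family_conj => // x xV.
  by rewrite -[in LHS](sV x xV) permK.
have -> : related p (q ^ s) = related p q by rewrite -{1}ps related_conj.
congr [&& _, _ & _].
by have := permJ q s u; rewrite su => ->; rewrite -sv (inj_eq perm_inj).
Qed.

(** All related q are sorted by the value q u: it is never u, the value p u is [card_related_edge],
    and the other 2 (n + 4) values contribute equally. *)
Lemma card_related_nonedge p V u v n : fpf_involution p -> stable p V ->
  u \in V -> v \in V -> v != u -> v != p u -> #|V| = (2 * (n + 5))%N ->
  ((2 * (n + 4)) * #|[set q in family p V | related p q & q u == v]|
   + 384 * 'C(n + 4, 5) = 384 * 'C(n + 5, 5))%N.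
Proof.
move=> fp pV uV vV vu vpu cV.
rewrite -(card_related fp pV cV) -(card_related_edge fp pV uV cV).
rewrite -[in RHS]sum1_card (partition_big (fun q : {perm T} => q u) (mem V)) /=.
  have sumE w : (\sum_(q in [set q in family p V | related p q] | q u == w) 1
      = #|[set q in family p V | related p q & q u == w]|)%N.
    by rewrite -sum1_card; apply: eq_bigl => q; rewrite !in_set andbA.
  under [RHS]eq_bigr => w _ do rewrite sumE.
  rewrite (bigD1 (p u)) ?stableE //= addnC; congr (_ + _)%N.
  rewrite (bigD1 u) /=; last by rewrite uV eq_sym fpf_neq.
  rewrite [X in _ = (X + _)%N](_ : _ = 0%N) ?add0n; last first.
    apply/eqP; rewrite cards_eq0; apply/eqP/setP => q; rewrite in_set in_set0.
    by apply/negP => /and3P[/family_fpf fq _]; rewrite (negPf (fpf_neq u fq)).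
  rewrite (eq_bigr (fun _ => #|[set q in family p V | related p q & q u == v]|)).
    rewrite sum_nat_const; congr (_ * _)%N.
    have := cardsD_edge fp pV uV (_ : #|V| = (2 * (n + 4).+1)%N).
    rewrite -addnS => /(_ cV) <-; apply: eq_card => w.
    by rewrite !inE [RHS]unfold_in; case: (w \in V); case: (w == u); case: (w == p u).
  move=> w /andP[/andP[wV wpu] wu]; exact: card_related_nonedge_const.
move=> q; rewrite in_set => /andP[qF _].
by rewrite (stableE _ (family_fpf qF)) // (family_stable fp pV qF).
Qed.

End Counting.

Definition valency n : algC := (384 * 'C(n, 5))%:R.

(* By double counting, the number of Q related to P and containing a given pair
   that is not an edge of P. *)
Definition crossing n : algC := (valency n - valency n.-1) / (2 * n.-1)%:R.

(** Applied to the indicator of an edge, A takes the value [valency n.-1] on matchings containing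
    the edge and [crossing n] on the others. The difference is therefore the eigenvalue on
    combinations of indicators with coefficient sum zero. *)
Definition second_eigenvalue n : algC := valency n.-1 - crossing n.

Lemma valencyE n (x := n%:R : algC) :
  valency (n + 5) = 16 / 5 * ((x + 5) * (x + 4) * (x + 3) * (x + 2) * (x + 1)).
Proof.
have : ('C(n + 5, 5) * 120 = (n + 5) * ((n + 4) * ((n + 3) * ((n + 2) * (n + 1)))))%N.
  rewrite -[120%N]/(5`!) bin_ffact !ffactnS ffactn0 muln1.
  by rewrite !addnS addn0 /=.
move/(congr1 (fun k => k%:R : algC)).
rewrite !natrM !natrD -/x => E.
by rewrite /valency natrM -[X in _ * X](mulfK (_ : 120%:R != 0)) ?E ?pnatr_eq0 //; field.
Qed.

Lemma second_eigenvalueE n (x := n%:R : algC) :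
  second_eigenvalue (n + 5) = 8 / 5 * ((x + 1) * (x + 2) * (x + 3) * (2 * x * (x + 4) - 5)).
Proof.
have v4 : valency (n + 4) = 16 / 5 * ((x + 4) * (x + 3) * (x + 2) * (x + 1) * x).
  rewrite /x; case: n {x} => [|n]; first by rewrite /valency bin_small // !(mulr0, mulr0n, muln0).
  by rewrite addSnnS valencyE -natr1; ring.
have x4 : x + 4 != 0 by rewrite -natrD pnatr_eq0 addnS.
rewrite /second_eigenvalue /crossing addnS /= -addnS v4 valencyE -/x natrM natrD -/x.
by field.
Qed.

(** The right side being nonnegative is exactly the inequality that closes the induction in
    [energy_bound]. *)
Lemma second_eigenvalue_step n :
  n.+2%:R * second_eigenvalue (n.+2 + 5) - (n.+2 + 5)%:R * second_eigenvalue (n.+1 + 5)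
    = (16 * (n + 6) * (n + 4) * (n + 3) * n.+2)%:R.
Proof.
rewrite !second_eigenvalueE !natrM !natrD -![n.+2%:R]natr1 -![n.+1%:R]natr1; by field.
Qed.

(** * The relation as an operator on functions on a family *)

Section Operator.
Variables (T : finType) (p0 : {perm T}) (V : {set T}).
Hypotheses (fp0 : fpf_involution p0) (pV : stable p0 V).
Implicit Types (p q r : {perm T}) (x y u v : T) (f g h : {perm T} -> algC).

Local Notation M := (family p0 V).

Lemma sum_related n p : #|V| = (2 * (n + 5))%N -> p \in M ->
  \sum_(q in M) (related p q)%:R = valency (n + 5).
Proof.
move=> cV pM; have fp := family_fpf pM; have ppV := family_stable fp0 pV pM.
rewrite -(family_eq pM) /valency -(card_related fp ppV cV) -sum1_card natr_sum.
under [LHS]eq_bigr => q _ do rewrite mulrb.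
by rewrite -big_mkcondr; apply: eq_bigl => q; rewrite [RHS]in_set.
Qed.

Lemma related_indicator n p x y : #|V| = (2 * (n + 5))%N -> p \in M ->
  x \in V -> y \in V -> x != y ->
  \sum_(q in M) (related p q)%:R * (q x == y)%:R
    = second_eigenvalue (n + 5) * (p x == y)%:R + crossing (n + 5).
Proof.
move=> cV pM xV yV xy; have fp := family_fpf pM; have ppV := family_stable fp0 pV pM.
transitivity (#|[set q in family p V | related p q & q x == y]|%:R : algC).
  rewrite -(family_eq pM) -sum1_card natr_sum.
  under [LHS]eq_bigr => q _ do rewrite -natrM mulnb mulrb.
  by rewrite -big_mkcondr; apply: eq_bigl => q; rewrite [RHS]in_set.
have n4 : (n + 5).-1 = (n + 4)%N by rewrite addnS.
have [<-|pxy] := eqVneq (p x) y.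
  rewrite (card_related_edge fp ppV xV cV) mulr1 subrK /valency.
  by rewrite n4.
have := @card_related_nonedge _ p V x y n fp ppV xV yV _ _ cV.
rewrite eq_sym xy eq_sym pxy => /(_ isT isT) /(congr1 (fun k => k%:R : algC)) E.
rewrite mulr0 add0r /crossing n4 /valency -E natrD addrK natrM mulrAC mulfV ?mul1r //.
by rewrite pnatr_eq0 !addnS muln_eq0.
Qed.

Definition edge_combination (F : T -> T -> algC) p : algC :=
  \sum_(x in V) \sum_(y in V) F x y * (p x == y)%:R.

Lemma related_edge_combination n p F : #|V| = (2 * (n + 5))%N -> p \in M ->
  (forall x, F x x = 0) -> \sum_(x in V) \sum_(y in V) F x y = 0 ->
  \sum_(q in M) (related p q)%:R * edge_combination F q
    = second_eigenvalue (n + 5) * edge_combination F p.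
Proof.
move=> cV pM Fxx F0.
transitivity (second_eigenvalue (n + 5) * edge_combination F p
    + crossing (n + 5) * (\sum_(x in V) \sum_(y in V) F x y)); last first.
  by rewrite F0 mulr0 addr0.
under [LHS]eq_bigr => q _ do rewrite mulr_sumr.
rewrite [LHS]exchange_big /edge_combination !mulr_sumr -big_split /=.
apply: eq_bigr => x xV.
under eq_bigr => q _ do rewrite mulr_sumr.
rewrite exchange_big !mulr_sumr -big_split /=.
apply: eq_bigr => y yV.
under eq_bigr => q _ do rewrite mulrCA.
rewrite -mulr_sumr.
have [<-|xy] := eqVneq x y; first by rewrite Fxx !(mul0r, mulr0) addr0.
by rewrite (related_indicator cV) // mulrDr mulrCA [crossing _ * _]mulrC.
Qed.

Lemma sum_edge_split f x : x \in V ->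
  \sum_(y in V) \sum_(p in M | p x == y) f p = \sum_(p in M) f p.
Proof.
move=> xV; rewrite [RHS](partition_big (fun p => p x) (mem V)) //= => p pM.
by rewrite (stableE _ (family_fpf pM)) // (family_stable fp0 pV pM).
Qed.

(** A related pair p, q occurs on the right once for each point x of V with p x = q x, and there are
    |V| - 10 = 2n such points. *)
Lemma energy_edges n g : #|V| = (2 * (n + 5))%N ->
  (2 * n)%:R * energy M g
    = \sum_(x in V) \sum_(y in V) energy [set p in M | p x == y] g.
Proof.
move=> cV; rewrite /energy.
transitivity (\sum_(x in V) \sum_(y in V) \sum_(p in M) \sum_(q in M)
   (related p q && (p x == y) && (q x == y))%:R * (g q * (g p)^*)); last first.
  apply: eq_bigr => x xV; apply: eq_bigr => y yV.
  rewrite [RHS](eq_bigl (fun p => (p \in M) && (p x == y))); last first.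
    by move=> p; rewrite [LHS]in_set.
  rewrite [RHS]big_mkcondr; apply: eq_bigr => p pM; case: eqP => pxy; last first.
    by rewrite big1 // => q _; rewrite andbF mul0r.
  rewrite [RHS](eq_bigl (fun q => (q \in M) && (q x == y))); last first.
    by move=> q; rewrite [LHS]in_set.
  rewrite [RHS]big_mkcondr; apply: eq_bigr => q qM; rewrite andbT.
  by case: eqP; rewrite ?andbT // andbF mul0r.
under [RHS]eq_bigr => x _ do rewrite exchange_big /=.
rewrite [RHS]exchange_big mulr_sumr; apply: eq_bigr => p pM.
under [RHS]eq_bigr => x _ do rewrite exchange_big /=.
rewrite [RHS]exchange_big mulr_sumr; apply: eq_bigr => q qM.
under [RHS]eq_bigr => x _ do rewrite -mulr_suml.
rewrite -mulr_suml mulrA; congr (_ * _).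
case pq: (related p q); last by rewrite mulr0 big1 // => x _; rewrite big1.
have fp := family_fpf pM; have ppV := family_stable fp0 pV pM.
rewrite -(family_eq pM) in qM.
have := card_common qM pq; rewrite cV mulnDr => /addIn <-.
rewrite mulr1 -sum1_card natr_sum.
rewrite [LHS](eq_bigl (fun x => (x \in V) && (q x == p x))); last first.
  by move=> x; rewrite [LHS]in_set.
rewrite big_mkcondr; apply: eq_bigr => x xV.
rewrite (bigD1 (p x)) ?stableE //= eqxx -mulrb big1 ?addr0 // => y /andP[_ /negPf].
by rewrite eq_sym => ->.
Qed.

Lemma edge_combinationE F p : p \in M ->
  edge_combination F p = \sum_(x in V) F x (p x).
Proof.
move=> pM; apply: eq_bigr => x xV.
rewrite (bigD1 (p x)) ?(stableE _ (family_fpf pM) (family_stable fp0 pV pM)) //=.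
rewrite eqxx mulr1 big1 ?addr0 // => y /andP[_ /negPf].
by rewrite eq_sym => ->; rewrite mulr0.
Qed.

Lemma sum_off_pair (G : T -> algC) x y : x \in V -> y \in V -> x != y ->
  \sum_(v in V :\: [set x; y]) G v = \sum_(v in V) G v - G x - G y.
Proof.
move=> xV yV xy; rewrite [in RHS](bigD1 x) //= [in RHS](bigD1 y) ?yV 1?eq_sym //=.
rewrite [G x + _]addrC addrK [G y + _]addrC addrK.
apply: eq_bigl => v; rewrite !inE; case: (v \in V); case: (v == x) => //=;
  by rewrite ?andbT ?andbF.
Qed.

Definition edge_sum f x y : algC := \sum_(p in M | p x == y) f p.

Lemma edge_sum_diag f x : edge_sum f x x = 0.
Proof.
by rewrite /edge_sum big_pred0 // => p; apply/negP => /andP[/family_fpf fp];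
  apply/negP/fpf_neq.
Qed.

Lemma edge_sum_sym f x y : edge_sum f x y = edge_sum f y x.
Proof.
apply: eq_bigl => p; case: (boolP (p \in M)) => //= /family_fpf fp.
by rewrite fpf_eqC.
Qed.

Lemma sum_edge_sum_row f x : x \in V -> \sum_(p in M) f p = 0 ->
  \sum_(y in V) edge_sum f x y = 0.
Proof. by move=> xV f0; rewrite /edge_sum sum_edge_split. Qed.

(** All rows of the symmetric array [edge_sum f] add up to zero, so deleting the rows and columns of
    x and y leaves only the two corner entries at (x, y) and (y, x). *)
Lemma sum_edge_sum_off f x y : x \in V -> y \in V -> x != y ->
  \sum_(p in M) f p = 0 ->
  \sum_(u in V :\: [set x; y]) \sum_(v in V :\: [set x; y]) edge_sum f u v
    = 2 * edge_sum f x y.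
Proof.
move=> xV yV xy f0.
have row z : z \in V -> \sum_(u in V :\: [set x; y]) edge_sum f z u
    = - edge_sum f z x - edge_sum f z y.
  by move=> zV; rewrite sum_off_pair // sum_edge_sum_row // sub0r.
transitivity (\sum_(u in V :\: [set x; y]) (- edge_sum f x u - edge_sum f y u)).
  apply: eq_bigr => u; rewrite in_setD => /andP[_ uV].
  by rewrite row // ![edge_sum f u _]edge_sum_sym.
rewrite big_split /= !sumrN !row // !edge_sum_diag [edge_sum f y x]edge_sum_sym.
by ring.
Qed.

(** This makes the Gram matrix of the edge indicators act as a scalar on the edge sums of f. The
    edge x y, counted from both ends, contributes 2 [odd_fact n.+1]. Any disjoint edge lies in
    [odd_fact n] of the matchings through x y, and [sum_edge_sum_off] adds up these
    contributions. *)
Lemma edge_combination_fiber n f x y : #|V| = (2 * n.+2)%N ->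
  x \in V -> y \in V -> x != y -> \sum_(p in M) f p = 0 ->
  \sum_(p in M | p x == y) edge_combination (edge_sum f) p
    = (2 * (odd_fact n.+1 + odd_fact n))%:R * edge_sum f x y.
Proof.
move=> cV xV yV xy f0.
have [q qM qx] := family_edge_exists fp0 pV xV yV xy.
have fq := family_fpf qM; have qV := family_stable fp0 pV qM.
have cV' := cardsD_edge fq qV xV cV; have qV' := stableD x fq qV.
have fib : [set p in M | p x == y] = family q (V :\: [set x; y]).
  by rewrite -qx -(family_edge x fp0 pV qM).
rewrite qx in cV' qV'.
transitivity (\sum_(p in family q (V :\: [set x; y]))
   (2 * edge_sum f x y + \sum_(u in V :\: [set x; y]) edge_sum f u (p u))).
  rewrite -fib; apply: eq_big => [p|p /andP[pM /eqP px]]; first by rewrite [RHS]in_set.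
  rewrite edge_combinationE // sum_off_pair // px.
  have -> : p y = x by rewrite -px fpfK // (family_fpf pM).
  by rewrite [edge_sum f y x]edge_sum_sym; ring.
rewrite big_split sumr_const (card_family fq qV' cV') /= exchange_big /=.
have -> : \sum_(u in V :\: [set x; y]) \sum_(p in family q (V :\: [set x; y]))
       edge_sum f u (p u) = (odd_fact n)%:R * (2 * edge_sum f x y).
  rewrite -(sum_edge_sum_off xV yV xy f0) mulr_sumr; apply: eq_bigr => u uV'.
  rewrite (partition_big (fun p : {perm T} => p u) (mem (V :\: [set x; y]))) /=.
    rewrite mulr_sumr; apply: eq_bigr => v vV'.
    have [<-|uv] := eqVneq u v.
      rewrite edge_sum_diag mulr0 big1 // => p /andP[_ /eqP->]; exact: edge_sum_diag.
    have [r rM ru] := family_edge_exists fq qV' uV' vV' uv.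
    have fr := family_fpf rM; have rV' := family_stable fq qV' rM.
    have := card_family fr (stableD u fr rV') (cardsD_edge fr rV' uV' cV').
    rewrite -(family_edge u fq qV' rM) ru => <-.
    rewrite -sum1_card natr_sum mulr_suml; apply: eq_big => [p|p /andP[_ /eqP->]].
      by rewrite [RHS]in_set.
    by rewrite mul1r.
  move=> p pM'; rewrite (stableE _ (family_fpf pM')) //.
  exact: family_stable fq qV' pM'.
by rewrite -mulr_natl !natrM natrD; ring.
Qed.

Lemma energy_orthogonal_step n c g : #|V| = (2 * (n.+1 + 5))%N ->
  (forall q W, fpf_involution q -> stable q W -> #|W| = (2 * (n + 5))%N ->
     forall h, \sum_(p in family q W) h p = 0 ->
       energy (family q W) h <= c * \sum_(p in family q W) `|h p| ^+ 2) ->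
  (forall x y, x \in V -> y \in V -> \sum_(p in M | p x == y) g p = 0) ->
  (2 * n.+1)%:R * energy M g <= (2 * (n.+1 + 5))%:R * c * \sum_(p in M) `|g p| ^+ 2.
Proof.
move=> cV IH g0; rewrite (energy_edges g cV).
have -> : (2 * (n.+1 + 5))%:R * c * \sum_(p in M) `|g p| ^+ 2
    = \sum_(x in V) \sum_(y in V) c * \sum_(p in [set p in M | p x == y]) `|g p| ^+ 2.
  rewrite -mulrA mulr_natl -cV -sumr_const; apply: eq_bigr => x xV.
  rewrite -mulr_sumr -(sum_edge_split (fun p => `|g p| ^+ 2) xV); congr (_ * _).
  by apply: eq_bigr => y yV; apply: eq_bigl => p; rewrite [RHS]in_set.
apply: ler_sum => x xV; apply: ler_sum => y yV.
have g0' : \sum_(p in [set p in M | p x == y]) g p = 0.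
  by rewrite -[RHS](g0 x y) //; apply: eq_bigl => p; rewrite [LHS]in_set.
have [E|[q]] := set_0Vmem [set p in M | p x == y].
  by rewrite E /energy !big_set0 mulr0.
rewrite in_set => /andP[qM /eqP qx]; have fq := family_fpf qM.
have qV := family_stable fp0 pV qM.
rewrite -qx (family_edge x fp0 pV qM) in g0' *.
by apply: IH; rewrite ?stableD //; exact: cardsD_edge cV.
Qed.

Lemma energy_sum f : energy M f
  = \sum_(p in M) (f p)^* * \sum_(q in M) (related p q)%:R * f q.
Proof.
apply: eq_bigr => p _; rewrite mulr_sumr; apply: eq_bigr => q _.
by ring.
Qed.

(* w is the orthogonal projection of f on the span of the edge indicators. *)
Lemma energy_project n f : #|V| = (2 * (n + 5))%N -> \sum_(p in M) f p = 0 ->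
  exists w g : {perm T} -> algC,
    [/\ forall x y, x \in V -> y \in V -> \sum_(p in M | p x == y) g p = 0,
        energy M f = second_eigenvalue (n + 5) * \sum_(p in M) `|w p| ^+ 2 + energy M g
      & \sum_(p in M) `|f p| ^+ 2
          = \sum_(p in M) `|w p| ^+ 2 + \sum_(p in M) `|g p| ^+ 2].
Proof.
move=> cV f0.
have cV2 : #|V| = (2 * (n + 3).+2)%N by rewrite cV !addnS.
(* The inverse of the scalar in [edge_combination_fiber]: with it, w has the same edge sums as f, so
   g = f - w has edge sums zero. *)
pose k : algC := (2 * (odd_fact (n + 3).+1 + odd_fact (n + 3)))%:R^-1.
have of_gt0 m : (0 < odd_fact m)%N by elim: m => //= m IHm; rewrite muln_gt0.
pose w p := k * edge_combination (edge_sum f) p; pose g p := f p - w p.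
have wfib x y : x \in V -> y \in V -> \sum_(p in M | p x == y) w p = edge_sum f x y.
  move=> xV yV; have [<-|xy] := eqVneq x y.
    rewrite edge_sum_diag big_pred0 // => p.
    by apply/negP => /andP[/family_fpf fp]; apply/negP/fpf_neq.
  rewrite -mulr_sumr (edge_combination_fiber cV2) // /k mulKf //.
  by rewrite pnatr_eq0 -lt0n muln_gt0 addn_gt0 !of_gt0.
have g0 x y : x \in V -> y \in V -> \sum_(p in M | p x == y) g p = 0.
  by move=> xV yV; rewrite sumrB wfib // subrr.
have Kw p : p \in M ->
    \sum_(q in M) (related p q)%:R * w q = second_eigenvalue (n + 5) * w p.
  move=> pM; under eq_bigr => q _ do rewrite mulrCA.
  rewrite -mulr_sumr (related_edge_combination cV) //; first by rewrite mulrCA.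
    exact: edge_sum_diag.
  by rewrite big1 // => x xV; rewrite sum_edge_sum_row.
have gw : \sum_(p in M) g p * (w p)^* = 0.
  rewrite /w; under eq_bigr => p _ do rewrite rmorphM /= mulrCA.
  rewrite -mulr_sumr; apply/eqP; rewrite mulf_eq0; apply/orP; right; apply/eqP.
  rewrite /edge_combination; under eq_bigr => p _ do rewrite rmorph_sum mulr_sumr.
  rewrite exchange_big big1 //= => x xV.
  under eq_bigr => p _ do rewrite rmorph_sum mulr_sumr.
  rewrite exchange_big big1 //= => y yV.
  under eq_bigr => p _ do rewrite rmorphM /= conjC_nat mulrCA.
  rewrite -mulr_sumr; under eq_bigr => p _ do rewrite mulr_natr mulrb.
  by rewrite -big_mkcondr g0 ?mulr0.
have wg : \sum_(p in M) w p * (g p)^* = 0.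
  transitivity ((\sum_(p in M) g p * (w p)^*)^*); last by rewrite gw conjC0.
  by rewrite rmorph_sum; apply: eq_bigr => p _; rewrite rmorphM /= conjCK mulrC.
have fE p : f p = w p + g p by rewrite addrC subrK.
exists w, g; split=> //; last first.
  transitivity (\sum_(p in M) (`|w p| ^+ 2 + `|g p| ^+ 2
      + (g p * (w p)^* + w p * (g p)^*))).
    by apply: eq_bigr => p _; rewrite !normCK fE rmorphD /=; ring.
  by rewrite 2!big_split big_split /= gw wg !addr0.
have Kf p : p \in M -> \sum_(q in M) (related p q)%:R * f q
    = second_eigenvalue (n + 5) * w p + \sum_(q in M) (related p q)%:R * g q.
  move=> pM; rewrite -Kw // -big_split; apply: eq_bigr => q _.
  by rewrite fE mulrDr.
rewrite !energy_sum; under eq_bigr => p pM do rewrite Kf // mulrDr.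
rewrite big_split /=; congr (_ + _).
  transitivity (second_eigenvalue (n + 5) * (\sum_(p in M) `|w p| ^+ 2
      + \sum_(p in M) w p * (g p)^*)); last by rewrite wg addr0.
  rewrite -big_split mulr_sumr; apply: eq_bigr => p _ /=.
  by rewrite normCK fE rmorphD /=; ring.
have adj (h : {perm T} -> algC) :
    \sum_(p in M) (h p)^* * (\sum_(q in M) (related p q)%:R * g q)
    = \sum_(q in M) g q * (\sum_(p in M) (related q p)%:R * h p)^*.
  under eq_bigr => p _ do rewrite mulr_sumr.
  rewrite exchange_big; apply: eq_bigr => q _; rewrite rmorph_sum mulr_sumr.
  by apply: eq_bigr => p _; rewrite rmorphM /= conjC_nat related_sym; ring.
rewrite (adj f) (adj g).
transitivity (\sum_(p in M) (g p * (w p)^* * (second_eigenvalue (n + 5))^*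
    + g p * (\sum_(q in M) (related p q)%:R * g q)^*)).
  by apply: eq_bigr => p pM; rewrite Kf // rmorphD rmorphM /=; ring.
by rewrite big_split /= -mulr_suml gw mul0r add0r.
Qed.

End Operator.

Lemma energy_bound (T : finType) n : forall (p : {perm T}) (V : {set T}),
  fpf_involution p -> stable p V -> #|V| = (2 * (n.+1 + 5))%N ->
  forall f : {perm T} -> algC, \sum_(q in family p V) f q = 0 ->
  energy (family p V) f
    <= second_eigenvalue (n.+1 + 5) * \sum_(q in family p V) `|f q| ^+ 2.
Proof.
elim: n => [|n IHn] p V fp pV cV f f0;
  have [w [g [g0 -> ->]]] := energy_project fp pV cV f0;
  rewrite mulrDr lerD2l.
  (* For twelve points the step gives 2 E <= 12 * 32 S, and 12 * 32 = 2 * 192 with 192 the second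
     eigenvalue for n = 6; hence an equality below. *)
  have ten (q : {perm T}) (W : {set T}) : fpf_involution q -> stable q W -> #|W| = (2 * (0 + 5))%N ->
      forall h, \sum_(p in family q W) h p = 0 ->
      energy (family q W) h <= 32%:R * \sum_(p in family q W) `|h p| ^+ 2.
    by move=> fq qW cW h; apply: energy_ten.
  have := energy_orthogonal_step fp pV cV ten g0.
  set S := \sum_(q in _) _ => H.
  rewrite -(ler_pM2l (_ : 0 < 2%:R)) ?ltr0n //; apply: le_trans H _.
  by rewrite second_eigenvalueE le_eqVlt; apply/orP; left; apply/eqP; field.
have := energy_orthogonal_step fp pV cV IHn g0.
set S := \sum_(q in _) _ => H.
have S0 : 0 <= S by apply: sumr_ge0 => q _; rewrite exprn_ge0.
rewrite -(ler_pM2l (_ : 0 < (2 * n.+2)%:R)) ?ltr0n //; apply: le_trans H _.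
rewrite mulrA; apply: ler_wpM2r => //.
rewrite -subr_ge0 !natrM -!mulrA -mulrBr second_eigenvalue_step -natrM.
exact: ler0n.
Qed.

(** * Isotypic components of the matching module *)

Section Modules.
Variables (F : fieldType) (gT : finGroupType) (G : {group gT}).

Lemma image_rsim n1 n2 (rG1 : mx_representation F G n1)
    (rG2 : mx_representation F G n2) (S : 'M_n1) (U : 'M_n2) (f : 'M_(n1, n2))
    (modS : mxmodule rG1 S) (modU : mxmodule rG2 U) :
  {in G, forall x, rG1 x *m f = f *m rG2 x} ->
  (forall w : 'rV_n1, (w <= S)%MS -> w *m f = 0 -> w = 0) ->
  (U :=: S *m f)%MS -> mx_rsim (submod_repr modU) (submod_repr modS).
Proof.
move=> homf injf US; apply: mx_rsim_sym.
pose B : 'M_(\rank S, \rank U) := in_submod U (val_submod 1%:M *m f).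
have valB m (W : 'M_(m, \rank S)) : val_submod (W *m B) = val_submod W *m f.
  rewrite /B [in_submod _ _]in_submodE mulmxA -in_submodE mulmxA -val_submodE.
  by rewrite in_submodK // US submxMr // val_submodP.
have freeB : row_free B.
  rewrite -kermx_eq0; apply/eqP/row_matrixP => i; rewrite row0.
  apply: (@val_submod_inj _ _ S); rewrite linear0; apply: injf; first exact: val_submodP.
  by rewrite -valB -row_mul mulmx_ker row0 linear0.
exists B => // [|x Gx].
  apply/eqP; rewrite eqn_leq; apply/andP; split; last by rewrite US mxrankM_maxl.
  by rewrite -[in X in (X <= _)%N](eqP freeB); exact: rank_leq_col.
apply: (@val_submod_inj _ _ U); rewrite val_submodJ // valB.
rewrite -[B]mul1mx valB -mulmxA -homf // mulmxA; congr (_ *m _).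
by rewrite -[submod_repr _ _]mul1mx val_submodJ.
Qed.

Lemma module_projection n (rG : mx_representation F G n) (U : 'M_n) :
  ([pchar F]^'.-group G)%g -> mxmodule rG U ->
  exists P : 'M_n, [/\ {in G, forall x, P *m rG x = rG x *m P},
                       (P <= U)%MS & U *m P = U].
Proof.
move=> charG modU.
have [V modV defUV dxUV] := mx_Maschke_pchar rG charG modU (submx1 U).
have UV0 : (U :&: V = 0)%MS by apply/mxdirect_addsP.
have /hom_mxP projUV := proj_mx_hom UV0 modU modV.
have fullUV : row_full (U + V)%MS by rewrite -sub1mx defUV.
exists (proj_mx U V); rewrite proj_mx_id // -[X in (X <= _)%MS]mul1mx proj_mx_sub.
split=> // x Gx; move: (proj_mx U V) projUV => P projUV.
by apply: (row_full_inj fullUV); rewrite !mulmxA projUV.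
Qed.

(** Composing an isomorphism from U to another submodule with an equivariant projection onto U
    extends it to an endomorphism of the whole module. A commutes with this endomorphism, so its
    eigenvalue is carried over to every copy of U. *)
Lemma component_eigenspace n (rG : mx_representation F G n) (A U : 'M_n) (a : F) :
  ([pchar F]^'.-group G)%g -> mxsimple rG U ->
  (forall f : 'M_n, {in G, forall x, f *m rG x = rG x *m f} -> f *m A = A *m f) ->
  (U <= eigenspace A a)%MS -> (component_mx rG U <= eigenspace A a)%MS.
Proof.
move=> charG simU commA sUA; have [I [W isoW ->]] := component_mx_def simU.
apply/sumsmx_subP => i _; have [f _ homf defW] := isoW i; rewrite -defW.
have [P [homP sPU idP]] := module_projection charG (mxsimple_module simU).
have homPf x : x \in G -> (P *m f) *m rG x = rG x *m (P *m f).
  move=> Gx; rewrite [RHS]mulmxA -homP //; have /submxP[D ->] := sPU.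
  by rewrite -!mulmxA; congr (_ *m _); rewrite !mulmxA (hom_mxP homf).
rewrite -[U in U *m f]idP -mulmxA; apply/eigenspaceP.
by rewrite -[LHS]mulmxA (commA _ homPf) [U *m (A *m _)]mulmxA (eigenspaceP sUA) -scalemxAl.
Qed.

(** U is the image of an equivariant projection, and A commutes with that projection. *)
Lemma commutant_stable n (rG : mx_representation F G n) (A U : 'M_n) :
  ([pchar F]^'.-group G)%g -> mxmodule rG U ->
  (forall f : 'M_n, {in G, forall x, f *m rG x = rG x *m f} -> f *m A = A *m f) ->
  (U *m A <= U)%MS.
Proof.
move=> charG modU commA; have [P [homP sPU idP]] := module_projection charG modU.
by rewrite -[U in U *m A]idP -mulmxA commA // !mulmxA mulmx_sub.
Qed.

End Modules.

Section PermutationModule.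
Variables (gT : finGroupType) (T1 T2 : finType).
Variables (to1 : {action gT &-> T1}) (to2 : {action gT &-> T2}).

Lemma permutation_mx_coef m (w : 'M_(m, #|T2|)) (g : gT) i (x : T2) :
  (w *m permutation_mx to2 g) i (enum_rank (to2 x g)) = w i (enum_rank x).
Proof.
rewrite mxE (bigD1 (enum_rank x)) //= mxE !enum_rankK eqxx mulr1 big1 ?addr0 //.
move=> j jx; rewrite mxE enum_rankK (inj_eq (act_inj to2 g)).
by rewrite -(inj_eq enum_rank_inj) enum_valK (negPf jx) mulr0.
Qed.

Lemma permutation_mx_homP (f : 'M[algC]_(#|T1|, #|T2|)) :
  (forall g, permutation_mx to1 g *m f = f *m permutation_mx to2 g) <->
  (forall g x y, f (enum_rank (to1 x g)) (enum_rank (to2 y g))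
                 = f (enum_rank x) (enum_rank y)).
Proof.
have rowE g x y : (permutation_mx to1 g *m f) (enum_rank x) y
    = f (enum_rank (to1 x g)) y.
  have /(congr1 (fun w : 'rV_#|T1| => (w *m f) 0 y)) := delta_permutation_mx to1 x g.
  by rewrite -mulmxA -!rowE !mxE.
split=> H g; last first.
  apply/matrixP => i j; rewrite -[i]enum_valK -[j]enum_valK.
  by rewrite -[enum_val j](actKV to2 g) permutation_mx_coef rowE H.
by move=> x y; rewrite -rowE H permutation_mx_coef.
Qed.

End PermutationModule.

(** * The matrix A on the matching module and bounds on its spectrum *)

Section MatchingMatrix.
Variable n : nat.
Implicit Types P Q : matching n.

Lemma relation_type_component P Q :
  relation_type P Q = component_type (mperm P) (mperm Q).
Proof.
rewrite /relation_type /component_type.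
have E : connect (union_adj P Q) =2 connect (union_rel (mperm P) (mperm Q)).
  by apply: eq_connect => x y; rewrite union_adjE.
suff -> : equivalence_partition (connect (union_adj P Q)) [set: 'I_(2 * n)]
    = equivalence_partition (connect (union_rel (mperm P) (mperm Q))) [set: 'I_(2 * n)] by [].
by apply: eq_imset => x; apply/setP => y; rewrite !inE E.
Qed.

Lemma involution_swap P Q : exists s, matching_act P s = Q /\ matching_act Q s = P.
Proof.
have [s [PQ QP]] := swap_involutions (mperm_fpf P) (mperm_fpf Q).
by exists s; split; apply: mperm_inj; rewrite mperm_act.
Qed.

(* Any two matchings can be exchanged by a permutation, so every matrix of the
   commutant is symmetric, and symmetric matrices with symmetric product commute. *)
Lemma commutant_comm (f h : 'M[algC]_#|{: matching n}|) :
  (forall s, f *m matching_repr n s = matching_repr n s *m f) ->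
  (forall s, h *m matching_repr n s = matching_repr n s *m h) -> f *m h = h *m f.
Proof.
have sym (e : 'M[algC]_#|{: matching n}|) :
    (forall s, e *m matching_repr n s = matching_repr n s *m e) -> e^T = e.
  move=> comm; have inv := (permutation_mx_homP _ _ e).1 (fun s => esym (comm s)).
  apply/matrixP => i j.
  rewrite mxE -[i]enum_valK -[j]enum_valK.
  have [s [ij ji]] := involution_swap (enum_val i) (enum_val j).
  by have := inv s (enum_val i) (enum_val j); rewrite /= ij ji.
move=> cf ch; have symfh : (f *m h)^T = f *m h.
  by apply: sym => s; rewrite -mulmxA ch mulmxA cf mulmxA.
by rewrite -symfh trmx_mul (sym f cf) (sym h ch).
Qed.

Definition standard_mate (x : 'I_(2 * n)) : 'I_(2 * n) :=
  Ordinal (partner_lt (ltn_ord x)).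

Lemma standard_mateK : involutive standard_mate.
Proof.
move=> x; apply: val_inj => /=; case: (val x) => // i; rewrite /partner /=.
by case: (boolP (odd i)) => oi /=; rewrite ?oi ?(negPf oi).
Qed.

Definition standard_perm : 'S_(2 * n) := perm (inv_inj standard_mateK).

Lemma standard_permE x : standard_perm x = standard_mate x.
Proof. by rewrite permE. Qed.

Lemma standard_fpf : fpf_involution standard_perm.
Proof.
apply/forallP => x; rewrite !standard_permE standard_mateK eqxx andbT.
apply/eqP => /(congr1 val) /=; rewrite /partner.
by case: (val x) => // i; case: ifP => _; lia.
Qed.

Lemma standard_stable : stable standard_perm [set: 'I_(2 * n)].
Proof. by apply/stableP => x _; rewrite inE. Qed.

Local Notation M := (family standard_perm [set: 'I_(2 * n)]).

Lemma sum_mperm (F : 'S_(2 * n) -> algC) :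
  \sum_(p in M) F p = \sum_(P : matching n) F (mperm P).
Proof.
have -> : M = [set mperm P | P : matching n].
  apply/setP => p; rewrite family_setT inE; apply/idP/imsetP => [/mperm_surj[P <-]|[P _ ->]].
    by exists P.
  exact: mperm_fpf.
by rewrite big_imset //; apply: in2W; apply: mperm_inj.
Qed.

Lemma mperm_family P : mperm P \in M.
Proof. by rewrite family_setT inE mperm_fpf. Qed.

(** Row vectors indexed by matchings become functions on permutations, zero off the fixed-point-free
    involutions, so that the results on [energy] apply. *)
Definition perm_coef (v : 'rV[algC]_#|{: matching n}|) (p : 'S_(2 * n)) : algC :=
  \sum_(P : matching n | mperm P == p) v 0 (enum_rank P).

Lemma perm_coefE v P : perm_coef v (mperm P) = v 0 (enum_rank P).
Proof.
by rewrite /perm_coef (big_pred1 P) // => Q; rewrite (inj_eq (@mperm_inj n)).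
Qed.

Variable k : nat.
Hypothesis nE : n = (k + 5)%N.

Local Notation A := (A_ n (5%N :: nseq (n - 5) 1%N)).
Local Notation mx1 := (const_mx 1 : 'rV[algC]_#|{: matching n}|).

Lemma A_entry P Q :
  A (enum_rank P) (enum_rank Q) = (related (mperm P) (mperm Q))%:R.
Proof.
rewrite mxE !enum_rankK relation_type_component.
rewrite (@component_typeE _ _ _ (mperm_fpf P) (mperm_fpf Q) (n - 5)) //.
by rewrite card_ord nE addnK.
Qed.

Lemma A_commute s : A *m matching_repr n s = matching_repr n s *m A.
Proof.
apply/esym; move: s; apply: (permutation_mx_homP _ _ A).2 => s P Q.
by rewrite !A_entry !mperm_act related_conj.
Qed.

Lemma mul_A_coef v P :
  (v *m A) 0 (enum_rank P) = \sum_(q in M) (related (mperm P) q)%:R * perm_coef v q.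
Proof.
rewrite mxE sum_mperm (reindex enum_rank) /=; last first.
  by exists enum_val => x _; rewrite (enum_rankK, enum_valK).
by apply: eq_bigr => Q _; rewrite A_entry related_sym mulrC perm_coefE.
Qed.

Lemma cardT2n : #|[set: 'I_(2 * n)]| = (2 * (k + 5))%N.
Proof. by rewrite cardsT card_ord nE. Qed.

Lemma eigenvector_coef v z p : v *m A = z *: v -> p \in M ->
  \sum_(q in M) (related p q)%:R * perm_coef v q = z * perm_coef v p.
Proof.
move=> vA /family_fpf/mperm_surj[P <-].
by rewrite -mul_A_coef vA mxE perm_coefE.
Qed.

Lemma eigenvector_energy v z : v *m A = z *: v ->
  energy M (perm_coef v) = z * \sum_(p in M) `|perm_coef v p| ^+ 2.
Proof.
move=> vA; rewrite energy_sum mulr_sumr; apply: eq_bigr => p pM.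
by rewrite (eigenvector_coef vA pM) normCK mulrCA [_^* * _]mulrC.
Qed.

Lemma eigenvector_sum v z : v *m A = z *: v -> z != valency n ->
  \sum_(p in M) perm_coef v p = 0.
Proof.
move=> vA zn; have : z * \sum_(p in M) perm_coef v p
    = valency n * \sum_(p in M) perm_coef v p.
  rewrite !mulr_sumr; under eq_bigr => p pM do rewrite -(eigenvector_coef vA pM).
  rewrite exchange_big; apply: eq_bigr => q qM; rewrite -mulr_suml; congr (_ * _).
  under eq_bigr => p _ do rewrite related_sym.
  by rewrite (sum_related standard_fpf standard_stable cardT2n qM) nE.
move/eqP; rewrite -subr_eq0 -mulrBl mulf_eq0 subr_eq0 (negPf zn) /=.
by move/eqP.
Qed.

Lemma perm_coef_norm_gt0 v : v != 0 -> 0 < \sum_(p in M) `|perm_coef v p| ^+ 2.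
Proof.
move=> v0; rewrite lt_def sumr_ge0 ?andbT => [|p _]; last by rewrite exprn_ge0.
apply: contraNneq v0 => S0; apply/eqP/rowP => i; rewrite -[i]enum_valK mxE.
have := psumr_eq0P (fun p _ => exprn_ge0 2 (normr_ge0 (perm_coef v p))) S0.
move/(_ _ (mperm_family (enum_val i)))/eqP; rewrite expf_eq0 /= normr_eq0 perm_coefE.
by move/eqP.
Qed.

Lemma mx1_eigenvector : mx1 *m A = valency n *: mx1.
Proof.
apply/rowP => i; rewrite -[i]enum_valK mul_A_coef !mxE mulr1.
rewrite [in RHS]nE -(sum_related standard_fpf standard_stable cardT2n (mperm_family (enum_val i))).
apply: eq_bigr => q /family_fpf/mperm_surj[Q <-].
by rewrite perm_coefE mxE mulr1.
Qed.

Lemma edge_eigenvector F (v : 'rV[algC]_#|{: matching n}|) :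
  (forall x, F x x = 0) -> \sum_x \sum_y F x y = 0 ->
  (forall P, v 0 (enum_rank P) = \sum_x \sum_y F x y * (mperm P x == y)%:R) ->
  v *m A = second_eigenvalue n *: v.
Proof.
move=> Fxx F0 vE.
have sumT (h : 'I_(2 * n) -> algC) : \sum_(x in [set: 'I_(2 * n)]) h x = \sum_x h x.
  by apply: eq_bigl => x; rewrite inE.
have coefE p : p \in M -> perm_coef v p = edge_combination [set: 'I_(2 * n)] F p.
  move=> /family_fpf/mperm_surj[P <-]; rewrite perm_coefE vE /edge_combination sumT.
  by apply: eq_bigr => x _; rewrite sumT.
apply/rowP => i; rewrite -[i]enum_valK mul_A_coef mxE -perm_coefE.
under eq_bigr => q qM do rewrite coefE //.
rewrite (related_edge_combination standard_fpf standard_stable cardT2n) ?mperm_family //.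
  by rewrite -nE coefE ?mperm_family.
by rewrite sumT -[RHS]F0; apply: eq_bigr => x _; rewrite sumT.
Qed.

Lemma valency_gap : valency n - second_eigenvalue n
  = (8 * ((k + 1) * (k + 2) * (k + 3) * (2 * k + 9)))%:R.
Proof.
by rewrite nE valencyE second_eigenvalueE !(natrM, natrD); field.
Qed.

Lemma second_lt_valency : second_eigenvalue n < valency n.
Proof. by rewrite -subr_gt0 valency_gap ltr0n !muln_gt0 !addn_gt0 !orbT. Qed.

Hypothesis k_gt0 : (0 < k)%N.

Lemma sum_zero_energy_bound f : \sum_(p in M) f p = 0 ->
  energy M f <= second_eigenvalue n * \sum_(p in M) `|f p| ^+ 2.
Proof.
move=> f0; have cT := cardT2n; rewrite -(prednK k_gt0) in cT.
have := energy_bound standard_fpf standard_stable cT f0.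
by rewrite (prednK k_gt0) -nE.
Qed.

Lemma eigenvector_bound (v : 'rV[algC]_#|{: matching n}|) z :
  v *m A = z *: v -> v != 0 -> z != valency n ->
  z <= second_eigenvalue n.
Proof.
move=> vA v0 zn; rewrite -(ler_pM2r (perm_coef_norm_gt0 v0)) -eigenvector_energy //.
exact/sum_zero_energy_bound/(eigenvector_sum vA).
Qed.

(** Subtracting the mean from v leaves an eigenvector with coefficient sum zero. If it were nonzero,
    the energy bound would put the valency below the second eigenvalue. *)
Lemma valency_eigenvector (v : 'rV[algC]_#|{: matching n}|) :
  v *m A = valency n *: v -> exists c, v = c *: mx1.
Proof.
move=> vA; pose c := (\sum_(p in M) perm_coef v p) / #|M|%:R.
pose w := v - c *: mx1; have wA : w *m A = valency n *: w.
  by rewrite mulmxBl vA -scalemxAl mx1_eigenvector scalerBr !scalerA [c * _]mulrC.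
have w0 : \sum_(p in M) perm_coef w p = 0.
  rewrite (eq_bigr (fun p => perm_coef v p - c)) => [|p /family_fpf/mperm_surj[P <-]].
    rewrite sumrB sumr_const -mulr_natr /c divfK ?subrr // pnatr_eq0 cards_eq0.
    by apply/set0Pn; exists standard_perm; rewrite family_refl ?standard_fpf.
  by rewrite !perm_coefE !mxE mulr1.
exists c; apply/eqP; rewrite -subr_eq0 -/w; apply/negPn/negP => wn0.
have := sum_zero_energy_bound w0; rewrite (eigenvector_energy wA).
by rewrite ler_pM2r ?perm_coef_norm_gt0 // (lt_geF second_lt_valency).
Qed.

End MatchingMatrix.

(** * James's submodule theorem for an equivariant image of a Specht module *)

Section SubmoduleTheorem.
Variables (m : nat) (nu : seq nat).
Hypotheses (nu_sum : sumn nu = m) (nu_sorted : sorted geq nu).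
Implicit Types (t s q : 'S_m).

Local Notation C t := (column_stabilizer nu t).
Local Notation e t := (polytabloid nu t).
Local Notation rG := (tabloid_repr m nu).
Local Notation row_space := 'rV[algC]_#|row_family m nu|.

(** The signed column sum of t acts here in an arbitrary representation, so that it can be moved
    across equivariant maps ([antisymmetrize_map]). *)
Definition antisymmetrize N (rho : mx_representation algC [set: 'S_m] N) t
    (v : 'rV_N) : 'rV_N :=
  \sum_(q in C t) (-1) ^+ q *: (v *m rho q).

(** The form is bilinear rather than Hermitian, to match the linearity of [antisymmetrize];
    definiteness on the Specht module is recovered in [specht_dot_eq0]. *)
Definition dot N (v w : 'rV[algC]_N) : algC := \sum_i v 0 i * w 0 i.

Lemma polytabloid_column t q : q \in C t -> e (t * q)%g = (-1) ^+ q *: e t.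
Proof.
move=> qt; rewrite {1}/polytabloid column_stabilizer_translate //.
rewrite [in RHS]/polytabloid [in RHS](reindex_inj (mulgI q)) scaler_sumr /=.
apply: eq_big => [s|s _]; first by rewrite column_stabilizerM.
by rewrite scalerA odd_permM signr_addb mulrA -signr_addb addbb mul1r mulgA.
Qed.

Lemma antisymmetrize_polytabloid t : antisymmetrize rG t (e t) = #|C t|%:R *: e t.
Proof.
rewrite /antisymmetrize (eq_bigr (fun=> e t)) => [|q qt].
  by rewrite sumr_const scaler_nat.
by rewrite polytabloidM polytabloid_column // scalerA -signr_addb addbb scale1r.
Qed.

Lemma polytabloid_coef t (X : row_family m nu) :
  e t 0 (enum_rank X) = \sum_(q in C t) (-1) ^+ q * (X == tabloid nu (t * q)%g)%:R.
Proof.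
rewrite summxE; apply: eq_bigr => q _; rewrite !mxE eqxx /=.
by rewrite (inj_eq enum_rank_inj).
Qed.

(** If two entries share a column of t and a row of s, their transposition fixes the tabloid of s,
    and the terms cancel in pairs; the tabloid then does not occur in the polytabloid either.
    Otherwise [column_transversal] makes the tabloid of s a column translate of that of t, and both
    sides are the polytabloid of t up to the same sign. *)
Lemma antisymmetrize_tabloid t s :
  antisymmetrize rG t (delta_mx 0 (enum_rank (tabloid nu s)))
    = e t 0 (enum_rank (tabloid nu s)) *: e t.
Proof.
have antiE : antisymmetrize rG t (delta_mx 0 (enum_rank (tabloid nu s)))
    = \sum_(q in C t) (-1) ^+ q *: delta_mx 0 (enum_rank (tabloid nu (s * q)%g)).
  by apply: eq_bigr => q _; rewrite delta_permutation_mx /= tabloidM.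
have [/existsP[y /existsP[z /and3P[yz /eqP cyz /eqP ryz]]]|none] := boolP
  [exists y : 'I_m, exists z : 'I_m, [&& y != z,
     reshape_offset nu ((t^-1)%g y) == reshape_offset nu ((t^-1)%g z)
   & reshape_index nu ((s^-1)%g y) == reshape_index nu ((s^-1)%g z)]].
  have tyz := column_stabilizer_tperm cyz.
  have -> : e t 0 (enum_rank (tabloid nu s)) = 0.
    rewrite polytabloid_coef big1 // => q qt; case: eqP => [/eqP E|]; rewrite ?mulr0 //.
    case/eqP: yz; move/(tabloid_eqP nu_sum): E => E.
    have cq x : reshape_offset nu ((t^-1)%g ((q^-1)%g x)) = reshape_offset nu ((t^-1)%g x).
      by rewrite -[in RHS](permKV q x) (column_stabilizerP _ _ _ qt).
    apply: (@perm_inj _ ((t * q)^-1)%g); apply: (@cell_inj _ nu).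
      by apply: etrans (esym (E y)) (etrans ryz (E z)).
    by rewrite !invMg !permM !cq.
  rewrite scale0r antiE; set S := \sum_(q in _) _.
  suff SN : S = - S.
    have : 2%:R *: S == 0 by rewrite scaler_nat mulr2n {1}SN addNr.
    by rewrite scaler_eq0 pnatr_eq0 => /eqP.
  rewrite {1}/S (reindex_inj (mulgI (tperm y z))) -sumrN.
  apply: eq_big => [q|q _]; first by rewrite column_stabilizerM.
  rewrite odd_permM odd_tperm yz signr_addb mulN1r scaleNr mulgA.
  congr (- (_ *: delta_mx 0 (enum_rank _))).
  rewrite -[LHS]tabloidM -[RHS]tabloidM; congr (row_family_act _ q).
  apply/eqP/(tabloid_eqP nu_sum) => x; rewrite invMg permM tpermV.
  by case: tpermP => // ->.
have [y z yz cyz|q0 q0t sE] := column_transversal nu_sum nu_sorted (t := t) (s := s).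
  apply: contraNneq none => ryz; apply/existsP; exists y; apply/existsP; exists z.
  by rewrite yz cyz ryz !eqxx.
have -> : e t 0 (enum_rank (tabloid nu s)) = (-1) ^+ q0.
  rewrite sE polytabloid_coef (bigD1 q0) //= eqxx mulr1 big1 ?addr0 //.
  move=> q /andP[qt qq0]; case: eqP => [E|]; rewrite ?mulr0 //.
  by case/eqP: qq0; apply: (tabloid_column_inj nu_sum qt q0t); rewrite E.
rewrite antiE -polytabloid_column // /polytabloid column_stabilizer_translate //.
apply: eq_bigr => q qt; congr (_ *: delta_mx 0 (enum_rank _)).
by rewrite -!tabloidM sE -tabloidM.
Qed.

Lemma antisymmetrize_linear N (rho : mx_representation algC [set: 'S_m] N) t
    (I : finType) (P : pred I) (c : I -> algC) (v : I -> 'rV_N) :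
  antisymmetrize rho t (\sum_(i | P i) c i *: v i)
    = \sum_(i | P i) c i *: antisymmetrize rho t (v i).
Proof.
rewrite /antisymmetrize; under [RHS]eq_bigr => i _ do rewrite scaler_sumr.
rewrite [RHS]exchange_big; apply: eq_bigr => q _.
rewrite mulmx_suml scaler_sumr; apply: eq_bigr => i _.
by rewrite -scalemxAl !scalerA mulrC.
Qed.

Lemma dot_sumZl N (w : 'rV[algC]_N) (I : finType) (P : pred I) (c : I -> algC)
    (v : I -> 'rV_N) :
  dot (\sum_(i | P i) c i *: v i) w = \sum_(i | P i) c i * dot (v i) w.
Proof.
rewrite /dot; under [RHS]eq_bigr => i _ do rewrite mulr_sumr.
rewrite [RHS]exchange_big; apply: eq_bigr => j _.
rewrite summxE mulr_suml; apply: eq_bigr => i _; by rewrite mxE mulrA.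
Qed.

Lemma specht_combination (v : row_space) :
  reflect (exists c : 'S_m -> algC, v = \sum_t c t *: e t) (v <= specht_mx m nu)%MS.
Proof.
apply: (iffP idP) => [/sub_sumsmxP[u ->]|[c ->]]; last first.
  apply: summx_sub => t _; apply: scalemx_sub; apply: (sumsmx_sup t) => //.
  by rewrite genmxE.
exists (fun t => (u t *m <<e t>>%MS *m pinvmx (e t)) 0 0); apply: eq_bigr => t _.
have ut : (u t *m <<e t>>%MS <= e t)%MS by rewrite -(genmxE (e t)) submxMl.
by rewrite -[LHS](mulmxKpV ut) -mul_scalar_mx -mx11_scalar.
Qed.

Lemma dotC N (v w : 'rV[algC]_N) : dot v w = dot w v.
Proof. by apply: eq_bigr => i _; rewrite mulrC. Qed.

Lemma antisymmetrize_specht t (v : row_space) : (v <= specht_mx m nu)%MS ->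
  antisymmetrize rG t v = dot v (e t) *: e t.
Proof.
have dotd (i : 'I_#|row_family m nu|) (w : row_space) : dot (delta_mx 0 i) w = w 0 i.
  rewrite /dot (bigD1 i) //= mxE !eqxx mul1r big1 ?addr0 // => j /negPf ji.
  by rewrite mxE ji andbF mul0r.
move=> /specht_combination[c ->].
rewrite antisymmetrize_linear dot_sumZl scaler_suml; apply: eq_bigr => s _.
rewrite -scalerA; congr (_ *: _).
rewrite {1 2}/polytabloid antisymmetrize_linear dot_sumZl scaler_suml.
by apply: eq_bigr => q _; rewrite antisymmetrize_tabloid dotd scalerA.
Qed.

(** Polytabloids have real coefficients, so the complex conjugate of v is again a combination of
    them. Pairing it with v gives the sum of the squared absolute values of the entries of v. *)
Lemma specht_dot_eq0 (v : row_space) : (v <= specht_mx m nu)%MS ->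
  (forall t, dot v (e t) = 0) -> v = 0.
Proof.
move=> /specht_combination[c vE] v0.
have conj_e t i : (e t 0 i)^* = e t 0 i.
  rewrite -[i]enum_valK polytabloid_coef rmorph_sum; apply: eq_bigr => q _.
  by rewrite rmorphM /= rmorph_sign rmorph_nat.
have vv : \sum_i `|v 0 i| ^+ 2 = 0.
  transitivity (dot (\sum_t (c t)^* *: e t) v).
    apply: eq_bigr => i _; rewrite normCK mulrC; congr (_ * _).
    rewrite vE !summxE rmorph_sum; apply: eq_bigr => t _.
    by rewrite !mxE rmorphM /= conj_e.
  by rewrite dot_sumZl big1 // => t _; rewrite dotC v0 mulr0.
apply/rowP => i; rewrite mxE; apply/eqP; rewrite -normr_eq0 -sqrf_eq0.
by apply/eqP/(psumr_eq0P _ vv) => // j _; rewrite exprn_ge0.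
Qed.

Variables (N : nat) (rho : mx_representation algC [set: 'S_m] N).
Variable f : 'M[algC]_(#|row_family m nu|, N).
Hypothesis homf : forall s, rG s *m f = f *m rho s.

Local Notation u := (e 1%g *m f).
Local Notation U := (<<specht_mx m nu *m f>>%MS).

Hypothesis u_neq0 : u != 0.

Lemma antisymmetrize_map t (v : row_space) :
  antisymmetrize rho t (v *m f) = antisymmetrize rG t v *m f.
Proof.
rewrite mulmx_suml; apply: eq_bigr => q _.
by rewrite -scalemxAl -!mulmxA homf.
Qed.

Lemma image_polytabloid t : e t *m f = u *m rho t.
Proof. by rewrite -mulmxA -homf mulmxA polytabloidM mul1g. Qed.

Lemma image_polytabloid_neq0 t : e t *m f != 0.
Proof.
have -> : e t *m f = u *m rho t by exact: image_polytabloid.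
apply: contraNneq u_neq0 => et0.
have -> : u = u *m rho t *m rho (t^-1)%g.
  by rewrite -[RHS]mulmxA -repr_mxM ?inE // mulgV repr_mx1 mulmx1.
by rewrite et0 mul0mx.
Qed.

(** Antisymmetrizing w f = 0 along t yields [dot w (e t)] times the nonzero image of the polytabloid
    of t, so w is orthogonal to all polytabloids. *)
Lemma specht_map_inj (w : row_space) : (w <= specht_mx m nu)%MS -> w *m f = 0 -> w = 0.
Proof.
move=> wS wf0; apply: specht_dot_eq0 => // t; apply/eqP.
have : dot w (e t) *: (e t *m f) == 0.
  rewrite scalemxAl -antisymmetrize_specht // -antisymmetrize_map wf0.
  by rewrite /antisymmetrize big1 // => q _; rewrite mul0mx scaler0.
by rewrite scaler_eq0 (negPf (image_polytabloid_neq0 t)) orbF.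
Qed.

Lemma image_sub (X : 'M_N) : mxmodule rho X -> (u <= X)%MS -> (U <= X)%MS.
Proof.
move=> modX uX; rewrite genmxE; apply/row_subP => i; rewrite row_mul.
have /specht_combination[c ->] := row_sub i (specht_mx m nu).
rewrite mulmx_suml; apply: summx_sub => t _; rewrite -scalemxAl scalemx_sub //.
by rewrite image_polytabloid mxmodule_trans ?inE.
Qed.

Lemma image_in : (u <= U)%MS.
Proof.
rewrite genmxE submxMr //; apply/specht_combination.
exists (fun t => (t == 1%g)%:R); rewrite (bigD1 1%g) //= eqxx scale1r big1 ?addr0 //.
by move=> t /negPf ->; rewrite scale0r.
Qed.

Lemma image_module : mxmodule rho U.
Proof.
apply/mxmoduleP => s sG; rewrite (eqmxMr _ (genmxE _)) -mulmxA -homf mulmxA genmxE.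
by rewrite submxMr //; apply: (mxmoduleP (specht_module m nu)).
Qed.

(** A nonzero vector w f of a submodule X has w not orthogonal to some polytabloid. Antisymmetrizing
    along the same tableau puts the image of that polytabloid into X, and its translates generate
    U. *)
Lemma image_simple : mxsimple rho U.
Proof.
split; first exact: image_module.
  by apply: contraNneq u_neq0 => U0; rewrite -submx0 -U0 image_in.
move=> X modX XU X0; have vX := nz_row_sub X; set v := nz_row X in vX.
have v0 : v != 0 by rewrite nz_row_eq0.
have : (v <= specht_mx m nu *m f)%MS by rewrite -(genmxE (_ *m f)) (submx_trans vX).
case/submxP=> D; rewrite mulmxA => vE; set w := D *m _ in vE.
have wS : (w <= specht_mx m nu)%MS by apply: submxMl.
have [t wt] : exists t, dot w (e t) != 0.
  apply/existsP; apply: contraNT v0; rewrite negb_exists => /forallP w0.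
  by rewrite vE (specht_dot_eq0 wS) ?mul0mx // => t; apply/eqP/negPn/w0.
apply: image_sub => //.
have etX : (e t *m f <= X)%MS.
  rewrite -[e t *m f]scale1r -(mulVf wt) -scalerA scalemx_sub // scalemxAl.
  rewrite -antisymmetrize_specht // -antisymmetrize_map -vE.
  by apply: summx_sub => q _; rewrite scalemx_sub // mxmodule_trans ?inE.
have -> : u = e t *m f *m rho (t^-1)%g.
  by rewrite (image_polytabloid t) -[RHS]mulmxA -repr_mxM ?inE // mulgV repr_mx1 mulmx1.
by rewrite mxmodule_trans ?inE.
Qed.

(** Antisymmetrization along the identity tableau multiplies u by the order of the column stabilizer
    and maps all of U into the line of u. Since it commutes with A and u A lies in U, the vector u A
    is a multiple of u. *)
Lemma image_eigenvector (A : 'M_N) : (forall s, A *m rho s = rho s *m A) ->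
  (U *m A <= U)%MS -> exists x, u *m A = x *: u /\ (U <= eigenspace A x)%MS.
Proof.
move=> commA UA.
have : (u *m A <= specht_mx m nu *m f)%MS.
  by rewrite -(genmxE (_ *m f)) (submx_trans (submxMr A image_in)).
case/submxP=> D; rewrite mulmxA => uAE; set w := D *m _ in uAE.
have wS : (w <= specht_mx m nu)%MS by apply: submxMl.
have C0 : (#|C (1%g : 'S_m)|%:R : algC) != 0.
  by rewrite pnatr_eq0 cards_eq0; apply/set0Pn; exists 1%g; apply: column_stabilizer1.
have cuA : #|C (1%g : 'S_m)|%:R *: (u *m A) = dot w (e 1%g) *: u.
  have -> : #|C (1%g : 'S_m)|%:R *: (u *m A) = antisymmetrize rho 1%g (u *m A).
    rewrite scalemxAl scalemxAl -antisymmetrize_polytabloid -antisymmetrize_map.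
    by rewrite mulmx_suml; apply: eq_bigr => q _; rewrite -scalemxAl -!mulmxA commA.
  by rewrite uAE antisymmetrize_map antisymmetrize_specht // scalemxAl.
exists (#|C (1%g : 'S_m)|%:R^-1 * dot w (e 1%g)).
have uA : u *m A = (#|C (1%g : 'S_m)|%:R^-1 * dot w (e 1%g)) *: u.
  by rewrite -scalerA -cuA scalerA mulVf // scale1r.
split=> //; apply: image_sub; last exact/eigenspaceP.
apply/mxmoduleP => s sG; apply/eigenspaceP.
have /eigenspaceP EA := submx_refl (eigenspace A (#|C (1%g : 'S_m)|%:R^-1 * dot w (e 1%g))).
by rewrite -mulmxA -commA mulmxA EA -scalemxAl.
Qed.
End SubmoduleTheorem.

(** * The map from tabloids to sums of matchings *)

Section RowMatched.
Variables (n : nat) (nu : seq nat).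
Hypothesis nu_sum : sumn nu = (2 * n)%N.
Implicit Types (P : matching n) (x y : 'I_(2 * n)) (s t q : 'S_(2 * n)).

Definition row_matched (X : row_family (2 * n) nu) P : bool :=
  [forall x, [exists i, (x \in X i) && (mperm P x \in X i)]].

Definition row_matching_mx : 'M[algC]_(#|row_family (2 * n) nu|, #|{: matching n}|) :=
  \matrix_(i, j) (row_matched (enum_val i) (enum_val j))%:R.

Lemma row_matched_act X P s :
  row_matched (row_family_act X s) (matching_act P s) = row_matched X P.
Proof.
rewrite /row_matched mperm_act; apply/forallP/forallP => H x; last first.
  rewrite -[x](permKV s) permJ; have /existsP[i Hi] := H ((s^-1)%g x).
  by apply/existsP; exists i; rewrite ffunE !(mem_imset _ _ (@perm_inj _ s)).
have /existsP[i] := H (s x); rewrite permJ ffunE !(mem_imset _ _ (@perm_inj _ s)).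
by move=> Hi; apply/existsP; exists i.
Qed.

Lemma row_matching_mx_hom s :
  tabloid_repr (2 * n) nu s *m row_matching_mx = row_matching_mx *m matching_repr n s.
Proof.
move: s; apply: (permutation_mx_homP _ _ row_matching_mx).2 => s X P.
by rewrite !mxE !enum_rankK /= row_matched_act.
Qed.

Lemma row_matched_tabloid s P :
  row_matched (tabloid nu s) P
    = [forall x, reshape_index nu ((s^-1)%g x) == reshape_index nu ((s^-1)%g (mperm P x))].
Proof.
apply: eq_forallb => x; apply/existsP/eqP => [[i]|E].
  by rewrite !(mem_tabloid) => /andP[/eqP-> /eqP->].
exists (Ordinal (reshape_indexP (cell_lt nu_sum ((s^-1)%g x)))).
by rewrite !mem_tabloid /= E eqxx.
Qed.

Lemma polytabloid_row_matching t P :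
  (polytabloid nu t *m row_matching_mx) 0 (enum_rank P)
    = \sum_(q in column_stabilizer nu t)
        (-1) ^+ q * (row_matched (tabloid nu (t * q)%g) P)%:R.
Proof.
rewrite mulmx_suml summxE; apply: eq_bigr => q _.
by rewrite -scalemxAl mxE -rowE !mxE !enum_rankK.
Qed.

Hypothesis nu_even : {in nu, forall a, ~~ odd a}.

(** All rows have even length, so each row begins at an even cell number. This makes the standard
    matching pair columns 2j and 2j+1 within every row. *)
Lemma odd_col x : odd (reshape_offset nu x) = odd x.
Proof.
rewrite -[in RHS](reshape_indexK nu x) oddD.
suff -> : odd (sumn (take (reshape_index nu x) nu)) = false by [].
elim: nu nu_even (reshape_index nu x) => [|a l IHl] ev [|k] //=.
rewrite oddD (negPf (ev a (mem_head _ _))) IHl // => b bl; apply: ev.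
by rewrite inE bl orbT.
Qed.

Lemma partner_cell x : let y := standard_perm n x in
  reshape_index nu y = reshape_index nu x
  /\ reshape_offset nu y = partner (reshape_offset nu x).
Proof.
set r := reshape_index nu; set c := reshape_offset nu => /=.
have lt_c := reshape_offsetP (cell_lt nu_sum x).
have lt_pc : (partner (c x) < nth 0 nu (r x))%N.
  have := nu_even (mem_nth 0%N (reshape_indexP (cell_lt nu_sum x))).
  move: lt_c; rewrite -/(r x) -/(c x) /partner.
  case: ifP => oc; first by move=> H _; apply: leq_ltn_trans (leq_pred _) H.
  by rewrite leq_eqVlt => /orP[/eqP <-|//]; rewrite /= oc.
suff pE : val (standard_perm n x) = flatten_index nu (r x) (partner (c x)).
  by rewrite /r /c pE flatten_indexKl // flatten_indexKr.
have xE : nat_of_ord x = flatten_index nu (r x) (c x) by rewrite reshape_indexK.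
have ox : odd x = odd (c x) by rewrite odd_col.
clear lt_c lt_pc; move: (r x) (c x) xE ox => i j xE ox.
rewrite standard_permE /= /partner ox xE /flatten_index.
case: j {xE ox} => [|j] /=; first by rewrite addn0 addn1.
by case: (odd j); rewrite /= !addnS.
Qed.

(* A column-permuted tableau whose rows are still unions of standard edges was
   permuted identically in the columns 2j and 2j+1, hence evenly. *)
Lemma row_matched_even q : q \in column_stabilizer nu 1%g ->
  (forall x, reshape_index nu ((q^-1)%g x)
             = reshape_index nu ((q^-1)%g (standard_perm n x))) ->
  ~~ odd_perm q.
Proof.
move=> qC rq; set r := reshape_index nu; set c := reshape_offset nu.
have cq x : c (q x) = c x.
  by move/column_stabilizerP: qC => /(_ x); rewrite invg1 !perm1.
have cqV x : c ((q^-1)%g x) = c x by rewrite -[in RHS](permKV q x) cq.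
have odd_c x : odd (c x) = odd x := odd_col x.
have rc_partner x : r (standard_perm n x) = r x /\ c (standard_perm n x) = partner (c x).
  exact: partner_cell.
have qs x : (q^-1)%g (standard_perm n x) = standard_perm n ((q^-1)%g x).
  apply: (@cell_inj _ nu); first by rewrite -rq -/(r _) -/(r _) (rc_partner _).1.
  by rewrite -/(c _) -/(c _) cqV !(rc_partner _).2 cqV.
have qs' x : q (standard_perm n x) = standard_perm n (q x).
  by apply: (@perm_inj _ (q^-1)%g); rewrite permK qs permK.
(* The part of q acting on the even columns. As q commutes with the standard matching, q is the
   product of h and its conjugate under that matching, two permutations of equal sign. *)
pose h x := if odd x then x else q x.
have odd_q x : odd (q x) = odd x by rewrite -odd_c cq odd_c.
have h_inj : injective h.
  move=> x y; rewrite /h; case: ifP => ox; case: ifP => oy //.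
  - by move=> E; rewrite E odd_q oy in ox.
  - by move=> E; rewrite -E odd_q ox in oy.
  by move/perm_inj.
have odd_s x : odd (standard_perm n x) = ~~ odd x.
  rewrite standard_permE /= /partner; case: ifP => ox /=; last by rewrite ox.
  by move: ox; case: (nat_of_ord x) => //= k; case: (odd k).
suff -> : q = (perm h_inj * perm h_inj ^ standard_perm n)%g.
  by rewrite odd_permM odd_permJ addbb.
have hE x : perm h_inj x = h x by rewrite permE.
have sK y : standard_perm n (standard_perm n y) = y by rewrite fpfK ?standard_fpf.
have hsE y : (perm h_inj ^ standard_perm n)%g y = standard_perm n (h (standard_perm n y)).
  by rewrite -[in LHS](sK y) permJ hE.
apply/permP => x; rewrite permM hE hsE /h.
have [ox|ox] := boolP (odd x); first by rewrite odd_s ox /= qs' sK.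
by rewrite odd_s odd_q ox /= sK.
Qed.

Hypothesis nu_sorted : sorted geq nu.

(** At the standard matching every nonzero term has sign +1 by [row_matched_even], and the identity
    contributes one, so nothing cancels. *)
Lemma row_matching_neq0 P : mperm P = standard_perm n ->
  (polytabloid nu 1%g *m row_matching_mx) 0 (enum_rank P) != 0.
Proof.
move=> PE; rewrite polytabloid_row_matching (bigD1 1%g) ?column_stabilizer1 //=.
have -> : row_matched (tabloid nu (1 * 1)%g) P = true.
  rewrite row_matched_tabloid PE; apply/forallP => x.
  by rewrite mulg1 invg1 !perm1 (partner_cell x).1.
rewrite odd_perm1 expr0 mulr1; apply: lt0r_neq0; apply: ltr_wpDr; rewrite ?ltr01 //.
apply: sumr_ge0 => q /andP[qC _]; rewrite mul1g row_matched_tabloid PE.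
case: forallP => [H|]; last by rewrite mulr0.
have /negPf-> : ~~ odd_perm q by apply: row_matched_even => // x; apply/eqP.
by rewrite expr0 mulr1 ler01.
Qed.

End RowMatched.

(** * Specht modules of doubled partitions inside the matching module *)

Section SpechtInMatchings.
Variables (n : nat) (la : seq nat).
Hypothesis la_part : is_partition_of n la.

Local Notation nu := [seq (2 * k)%N | k <- la].
Local Notation u := (polytabloid nu 1%g *m row_matching_mx n nu).

Lemma double_sum : sumn nu = (2 * n)%N.
Proof.
case/and3P: la_part => _ _ /eqP <-; elim: la => //= a l ->; by rewrite mulnDr.
Qed.

Lemma double_even : {in nu, forall a, ~~ odd a}.
Proof. by move=> _ /mapP[k _ ->]; rewrite mul2n odd_double. Qed.

Lemma double_sorted : sorted geq nu.
Proof.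
case/and3P: la_part => srt _ _; rewrite sorted_map; apply: sub_sorted srt => a b /=.
by rewrite leq_pmul2l.
Qed.

Lemma odd_column_perm : (1 < size la)%N ->
  exists2 q, q \in column_stabilizer nu (1%g : 'S_(2 * n)) & odd_perm q.
Proof.
case/and3P: la_part => _ /allP la1 _ sz.
have cell0 i : (i < 2)%N -> (0 < nth 0 nu i)%N.
  move=> i2; have il : (i < size la)%N by apply: leq_trans i2 _.
  by rewrite (nth_map 0%N) // muln_gt0 /= la1 ?mem_nth.
have [y [y0 cy]] := cell_exists double_sum (cell0 0%N isT).
have [z [z0 cz]] := cell_exists double_sum (cell0 1%N isT).
exists (tperm y z); first by apply: column_stabilizer_tperm; rewrite invg1 !perm1 cy cz.
by rewrite odd_tperm; apply/eqP => yz; move: y0; rewrite yz z0.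
Qed.

Lemma image_neq0 : u != 0.
Proof.
have [P PE] := mperm_surj (standard_fpf n).
have := row_matching_neq0 double_sum double_even PE.
by apply: contraNneq => ->; rewrite mxE.
Qed.

Lemma charS : ([pchar algC]^'.-group [set: 'S_(2 * n)])%g.
Proof. exact: algC'G_pchar. Qed.

Lemma specht_is_phi k : n = (k + 5)%N ->
  exists2 x, is_phi n la (5%N :: nseq (n - 5) 1%N) x
    & u *m A_ n (5%N :: nseq (n - 5) 1%N) = x *: u.
Proof.
move=> nE; set A := A_ _ _.
have hom := @row_matching_mx_hom n nu.
have commA (f : 'M_#|{: matching n}|) :
    {in [set: 'S_(2 * n)]%g, forall s, f *m matching_repr n s = matching_repr n s *m f} ->
    f *m A = A *m f.
  move=> cf; apply: commutant_comm => s; first by apply: cf; rewrite inE.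
  exact: (A_commute nE).
have simU := image_simple double_sum double_sorted hom image_neq0.
have modU := image_module hom.
have [x [ux Ux]] := image_eigenvector double_sum double_sorted hom
  (A_commute nE) (commutant_stable charS modU commA).
exists x => //; exists (<<specht_mx (2 * n) nu *m row_matching_mx n nu>>%MS).
  exists modU; apply: image_rsim (genmxE _).
    by move=> s _; apply: hom.
  by move=> w; apply: (specht_map_inj double_sum double_sorted hom image_neq0).
exact: component_eigenspace charS simU commA Ux.
Qed.

(** A valency eigenvector is constant and hence fixed by all permutations. A diagram with at least
    two rows has an odd column transposition, which negates u; so u would be zero. *)
Lemma specht_valency k : n = (k.+1 + 5)%N -> la <> [:: n] ->
  u *m A_ n (5%N :: nseq (n - 5) 1%N) <> valency n *: u.
Proof.
move=> nE lan uA; have [c uc] := valency_eigenvector nE isT uA.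
have sz : (1 < size la)%N.
  case/and3P: la_part lan => _ _ /eqP; case: (la) => [|a [|b l]] //=.
    by move=> n0; rewrite nE in n0.
  by rewrite addn0 => ->.
have [q qC qodd] := odd_column_perm sz; have hom := @row_matching_mx_hom n nu.
have := image_polytabloid hom q.
rewrite -[q in LHS]mul1g polytabloid_column // qodd expr1 scaleN1r mulNmx uc.
pose mx1 : 'rV[algC]_#|{: matching n}| := const_mx 1; rewrite -/mx1.
have -> : (c *: mx1) *m matching_repr n q = c *: mx1.
  apply/rowP => i; rewrite -[i]enum_valK -[enum_val i](actKV (matching_action n) q).
  by rewrite permutation_mx_coef !mxE.
move=> cN; have /eqP := image_neq0; apply; rewrite uc -/mx1.
have : 2%:R *: (c *: mx1) == 0.
  by rewrite scaler_nat mulr2n -{1}cN addNr.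
by rewrite scaler_eq0 pnatr_eq0 => /eqP.
Qed.

End SpechtInMatchings.

(** * The eigenvalues of [n] and [n-1,1] *)

Lemma specht_top n k : n = (k + 5)%N ->
  let u := polytabloid [:: (2 * n)%N] 1%g *m row_matching_mx n [:: (2 * n)%N] in
  u *m A_ n (5%N :: nseq (n - 5) 1%N) = valency n *: u.
Proof.
move=> nE u; have nu_sum : sumn [:: (2 * n)%N] = (2 * n)%N by rewrite /= addn0.
pose c := \sum_(q in column_stabilizer [:: (2 * n)%N] (1%g : 'S_(2 * n))) ((-1) ^+ q : algC).
suff -> : u = c *: const_mx 1.
  by rewrite -scalemxAl (mx1_eigenvector nE) !scalerA mulrC.
apply/rowP => i; rewrite -[i]enum_valK polytabloid_row_matching // !mxE mulr1.
have row0 (x : 'I_(2 * n)) : reshape_index [:: (2 * n)%N] x = 0%N.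
  by have := reshape_indexP (cell_lt nu_sum x); rewrite /= ltnS leqn0 => /eqP.
apply: eq_bigr => q _; rewrite (_ : row_matched _ _ = true) ?mulr1 //.
by rewrite row_matched_tabloid //; apply/forallP => x; rewrite !row0.
Qed.

(** The second row of [2n-2, 2] consists of the last two cells a and b, and the other row is then
    matched automatically: a matching lies in the rows of tableau q iff {q a, q b} is one of its
    edges. So u is a combination of edge indicators, and its coefficients sum to zero because an odd
    column permutation reverses the signs. *)
Lemma specht_sub n k : n = (k.+1 + 5)%N ->
  let nu := [:: (2 * (n - 1))%N; 2] in
  let u := polytabloid nu 1%g *m row_matching_mx n nu in
  u *m A_ n (5%N :: nseq (n - 5) 1%N) = second_eigenvalue n *: u.
Proof.
move=> nE nu u; have n0 : (0 < n)%N by rewrite nE.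
have nu_sum : sumn nu = (2 * n)%N by rewrite /= addn0; lia.
have lta : (2 * n - 2 < 2 * n)%N by lia.
have ltb : (2 * n - 1 < 2 * n)%N by lia.
pose a := Ordinal lta; pose b := Ordinal ltb.
have ab : a != b by rewrite -val_eqE /=; lia.
have row1 (x : 'I_(2 * n)) : reshape_index nu x = ((x == a) || (x == b)) :> nat.
  rewrite -!val_eqE /= /reshape_index /=; have := ltn_ord x.
  have [xlt|xge] := ltnP x (2 * n - 2)%N; move=> x2n.
    by rewrite (_ : x.+1 - 2 * (n - 1) == 0)%N /=; lia.
  rewrite (_ : (x.+1 - 2 * (n - 1) == 0)%N = false); last lia.
  by rewrite (_ : (x.+1 - 2 * (n - 1) - 2 == 0)%N = true) /=; lia.
have matched (q : 'S_(2 * n)) P :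
    row_matched (tabloid nu q) P = (mperm P (q a) == q b).
  have fP := mperm_fpf P; rewrite row_matched_tabloid //; apply/forallP/eqP => [H|E x].
    have : ((q^-1)%g (mperm P (q a)) == a) || ((q^-1)%g (mperm P (q a)) == b).
      by have := H (q a); rewrite !row1 permK eqxx /=; case: (_ || _).
    case/orP=> /eqP E; last by rewrite -E permKV.
    have := fpf_neq (q a) fP; by rewrite -[mperm P (q a)](permKV q) E eqxx.
  have qVE y z : ((q^-1)%g y == z) = (y == q z).
    by rewrite -(inj_eq (@perm_inj _ q) _ z) permKV.
  rewrite !row1 !qVE !(fpf_eqC x) // E.
  have -> : mperm P (q b) = q a by rewrite -E fpfK.
  by rewrite orbC (eq_sym x) (eq_sym x).
pose F x y : algC := \sum_(q in column_stabilizer nu (1%g : 'S_(2 * n)))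
   (-1) ^+ q * ((x == q a) && (y == q b))%:R.
apply: (edge_eigenvector nE (F := F)) => [x||P].
- rewrite /F big1 // => q _; case: eqP => [->|]; rewrite ?mulr0 //.
  by rewrite (inj_eq perm_inj) (negPf ab) mulr0.
- transitivity (\sum_(q in column_stabilizer nu (1%g : 'S_(2 * n))) ((-1) ^+ q : algC)).
    rewrite /F; under eq_bigr => x _ do rewrite exchange_big.
    rewrite exchange_big; apply: eq_bigr => q _.
    rewrite (bigD1 (q a)) //= (bigD1 (q b)) //= !eqxx mulr1.
    rewrite !big1 ?addr0 // => [x /negPf xa|y /negPf yb]; last by rewrite yb mulr0.
    by rewrite big1 // => y _; rewrite xa mulr0.
  have [q0 q0C q0odd] : exists2 q, q \in column_stabilizer nu (1%g : 'S_(2 * n)) & odd_perm q.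
    have la_part : is_partition_of n [:: (n - 1)%N; 1%N].
      by rewrite /is_partition_of /= nE; apply/and3P; split; lia.
    exact: (odd_column_perm la_part).
  set S := \sum_(q in _) _; suff SN : S = - S.
    have : 2%:R * S == 0 by rewrite mulr_natl mulr2n {1}SN addNr.
    by rewrite mulf_eq0 pnatr_eq0 => /eqP.
  rewrite {1}/S (reindex_inj (mulgI q0)) -sumrN; apply: eq_big => [q|q _].
    by rewrite column_stabilizerM.
  by rewrite odd_permM q0odd signr_addb mulN1r.
rewrite polytabloid_row_matching //.
rewrite /F; under [RHS]eq_bigr => x _ do under eq_bigr => y _ do rewrite mulr_suml.
under [RHS]eq_bigr => x _ do rewrite exchange_big.
rewrite [RHS]exchange_big; apply: eq_bigr => q _; rewrite mul1g matched.
rewrite (bigD1 (q a)) //= (bigD1 (q b)) //= !eqxx mulr1 !big1 ?addr0 //.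
  by move=> x /negPf xa; rewrite big1 // => y _; rewrite xa mulr0 mul0r.
by move=> y /negPf yb; rewrite yb mulr0 mul0r.
Qed.

Unset Implicit Arguments.
Set Strict Implicit.
Set Printing Implicit Defensive.

Theorem theorem4p8 (n : nat) (hn : (6 <= n)%N) :
  let mu := 5%N :: nseq (n - 5) 1%N in
  let top := [:: n] in
  let sub := [:: (n - 1)%N; 1%N] in
  exists phi : seq nat -> algC,
    (forall la : seq nat, is_partition_of n la -> is_phi n la mu (phi la)) /\
    is_second_largest_eigenvalue (A_ n mu) (phi sub) /\
    phi sub = 8 / 5 * (2 * n%:R ^+ 5 - 30 * n%:R ^+ 4 + 165 * n%:R ^+ 3
                       - 405 * n%:R ^+ 2 + 418 * n%:R - 120) /\
    (forall la : seq nat, is_partition_of n la -> la <> top ->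
       phi la <= phi sub) /\
    is_spectral_gap (A_ n mu) (phi top - phi sub) /\
    phi top - phi sub = 16 * n%:R ^+ 4 - 152 * n%:R ^+ 3 + 488 * n%:R ^+ 2
                        - 592 * n%:R + 192.
Proof.
move=> mu top sub; have [k nE] : exists k, n = (k.+1 + 5)%N by exists (n - 6)%N; lia.
have [P PE] := mperm_surj (standard_fpf n).
pose u la := polytabloid [seq (2 * j)%N | j <- la] 1%g
               *m row_matching_mx n [seq (2 * j)%N | j <- la].
(* The eigenvalue on u is read off at the standard matching, where u does not vanish; this gives a
   function of all sequences at once. *)
pose phi la := (u la *m A_ n mu) 0 (enum_rank P) / u la 0 (enum_rank P).
have uP0 la : is_partition_of n la -> u la 0 (enum_rank P) != 0.
  move=> la_part; apply: row_matching_neq0 PE; [exact: double_sum | exact: double_even].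
have phiE la x : is_partition_of n la -> u la *m A_ n mu = x *: u la -> phi la = x.
  by move=> la_part uA; rewrite /phi uA mxE mulfK ?uP0.
have topP : is_partition_of n top by rewrite /is_partition_of /= addn0 eqxx !andbT; lia.
have subP : is_partition_of n sub by rewrite /is_partition_of /= nE; apply/and3P; split; lia.
have phi_top : phi top = valency n by apply: phiE topP (specht_top nE).
have phi_sub : phi sub = second_eigenvalue n.
  by apply: phiE subP _; exact: (specht_sub nE).
have k0 : (0 < k.+1)%N by [].
have top_largest : is_largest_eigenvalue (A_ n mu) (phi top).
  rewrite phi_top; split.
    apply/eigenvalueP; exists (const_mx 1); first exact: mx1_eigenvector nE.
    by apply/eqP => /rowP/(_ (enum_rank P)); rewrite !mxE; apply/eqP; rewrite oner_eq0.
  move=> z /eigenvalueP[v vA v0]; have [->|zn] := eqVneq z (valency n); first exact: lexx.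
  exact: le_trans (eigenvector_bound nE k0 vA v0 zn) (ltW (second_lt_valency nE)).
have sub_second : is_second_largest_eigenvalue (A_ n mu) (phi sub).
  exists (phi top); split=> //.
  - apply/eigenvalueP; exists (u sub); last by apply: contraNneq (uP0 _ subP) => ->; rewrite mxE.
    by rewrite phi_sub; exact: (specht_sub nE).
  - by rewrite phi_top phi_sub (second_lt_valency nE).
  move=> z /eigenvalueP[v vA v0]; rewrite phi_top phi_sub.
  by move=> zn; exact: (eigenvector_bound nE k0 vA v0 zn).
have nR : n%:R = (k.+1)%:R + 5 :> algC by rewrite {1}nE natrD.
exists phi; split.
  move=> la la_part; have [x phix uA] := specht_is_phi la_part nE.
  by rewrite (phiE _ _ la_part uA).
split=> //; split; last split; last split.
- by rewrite phi_sub nR {1}nE second_eigenvalueE; field.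
- move=> la la_part la_top; have [x phix uA] := specht_is_phi la_part nE.
  rewrite (phiE _ _ la_part uA) phi_sub.
  apply: (eigenvector_bound nE k0 uA (image_neq0 la_part)).
  by apply/eqP => xn; apply: (specht_valency la_part nE la_top); rewrite uA xn.
- by exists (phi top), (phi sub).
by rewrite phi_top phi_sub (valency_gap nE) nR !(natrM, natrD); ring.
Qed.
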